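(* Let $\mathcal{A}$ be a unital operator algebra such that for every unital $C^*$-algebra $\mathcal{C}$, $\mathcal{A}\otimes_{\min}\mathcal{C}=\mathcal{A}\otimes_{\max}\mathcal{C}$ if and only if $\mathcal{C}$ is a nuclear $C^*$-algebra. Then for every non-unital $C^*$-algebra $\mathcal{D}$, $\mathcal{A}\otimes_{\min}\mathcal{D}=\mathcal{A}\otimes_{\max}\mathcal{D}$ if and only if $\mathcal{D}$ is a nuclear $C^*$-algebra.
   Context: Operator algebras are norm-closed, not necessarily selfadjoint, subalgebras of some $B(\mathcal{H})$. For approximately unital operator algebras $\mathcal{A}\subseteq B(\mathcal{H})$ and $\mathcal{E}\subseteq B(\mathcal{K})$, the minimal tensor product $\mathcal{A}\otimes_{\min}\mathcal{E}$ is the completion of $\mathcal{A}\otimes\mathcal{E}$ in the (matrix) norms inherited from $B(\mathcal{H}\otimes\mathcal{K})$. The maximal tensor product $\mathcal{A}\otimes_{\max}\mathcal{E}$ is the completion in $\|x\|_{\max}=\sup\|\pi\cdot\rho(x)\|$ (similarly for matrix norms), the supremum being over all Hilbert spaces $\mathcal{H}$ and all pairs of completely contractive representations $\pi:\mathcal{A}\to B(\mathcal{H})$, $\rho:\mathcal{E}\to B(\mathcal{H})$ with commuting ranges, where $\pi\cdot\rho(a\otimes b)=\pi(a)\rho(b)$. The equality $\mathcal{A}\otimes_{\min}\mathcal{E}=\mathcal{A}\otimes_{\max}\mathcal{E}$ means that the identity on $\mathcal{A}\otimes\mathcal{E}$ extends to a completely isometric isomorphism. *)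

(* Defs.v *)
From HB Require Import structures.
From mathcomp Require Import all_boot all_order all_algebra.
From mathcomp Require Import complex.
From mathcomp Require Import all_classical all_reals all_analysis.

Set Implicit Arguments.
Unset Strict Implicit.
Unset Printing Implicit Defensive.

Import Order.TTheory GRing.Theory Num.Theory Num.Def.
Import numFieldNormedType.Exports.

Local Open Scope classical_set_scope.
Local Open Scope ring_scope.
Local Open Scope complex_scope.

(* The inner product is linear in the first variable and conjugate-linear in
   the second one. *)
HB.mixin Record isHilbert (R : realType) V of CompleteNormedModule R[i] V := {
  inner : {dot V for conjC} ;
  sqr_normE : forall x : V, `|x| ^+ 2 = inner x x }.

#[short(type="hilbertType")]
HB.structure Definition Hilbert (R : realType) :=
  { V of isHilbert R V & CompleteNormedModule R[i] V }.

(* The norm of a normed R[i]-module takes its values in R[i]; hnorm is the same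
   number, seen in R. *)
Definition hnorm (R : realType) (H : hilbertType R) (x : H) : R :=
  complex.Re `|x|.

Definition bounded_op (R : realType) (H : hilbertType R) : set (H -> H) :=
  [set T | linear T /\ continuous T].

Definition opnorm (R : realType) (H : hilbertType R) (T : H -> H) : \bar R :=
  ereal_sup [set (hnorm (T v))%:E | v in [set v : H | hnorm v <= 1]].

(* The norm of the Hilbert sum of n copies of H. *)
Definition vecnorm (R : realType) (H : hilbertType R) (n : nat)
    (v : 'I_n -> H) : R :=
  Num.sqrt (\sum_(i < n) hnorm (v i) ^+ 2).

(* The norm of M_n(B(H)) = B(H^n). *)
Definition mxopnorm (R : realType) (H : hilbertType R) (n : nat)
    (T : 'M[H -> H]_n) : \bar R :=
  ereal_sup [set (vecnorm (fun i => \sum_(j < n) T i j (v j)))%:E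
            | v in [set v : 'I_n -> H | vecnorm v <= 1]].

Definition is_adjoint (R : realType) (H : hilbertType R) (T S : H -> H) : Prop :=
  forall x y : H, inner (T x) y = inner x (S y).

Definition norm_closed (R : realType) (H : hilbertType R) (A : set (H -> H)) :
    Prop :=
  forall T : H -> H, bounded_op T ->
    (forall e : R, 0 < e -> exists2 a, A a & (opnorm (T - a)%R < e%:E)%E) -> A T.

Definition operator_algebra (R : realType) (H : hilbertType R)
    (A : set (H -> H)) : Prop :=
  [/\ A `<=` @bounded_op R H,
      A 0 /\ (forall a b, A a -> A b -> A (a + b)),
      (forall (c : R[i]) a, A a -> A (c *: a)),
      (forall a b, A a -> A b -> A (a \o b)) &
      norm_closed A].

Definition cstar_algebra (R : realType) (H : hilbertType R)
    (A : set (H -> H)) : Prop :=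
  operator_algebra A /\ (forall a, A a -> exists2 b, A b & is_adjoint a b).

(* A unital operator algebra has a contractive identity, which need not be the
   identity operator of H.  In a C*-algebra contractivity is automatic: an
   identity is a selfadjoint projection. *)
Definition unital (R : realType) (H : hilbertType R) (A : set (H -> H)) : Prop :=
  exists e, [/\ A e, (opnorm e <= 1%:E)%E &
                forall a, A a -> e \o a = a /\ a \o e = a].

(* The values of pi outside A are irrelevant. *)
Definition cc_representation (R : realType) (H L : hilbertType R)
    (A : set (H -> H)) (pi : (H -> H) -> (L -> L)) : Prop :=
  [/\ (forall a, A a -> bounded_op (pi a)),
      (forall a b, A a -> A b -> pi (a + b) = pi a + pi b),
      (forall (c : R[i]) a, A a -> pi (c *: a) = c *: pi a),
      (forall a b, A a -> A b -> pi (a \o b) = pi a \o pi b) &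
      (forall (n : nat) (T : 'M[H -> H]_n), (forall i j, A (T i j)) ->
         (mxopnorm (map_mx pi T) <= mxopnorm T)%E)].

(* The list [:: (a1, b1); ..; (ak, bk)] represents the
   element a1 (x) b1 + .. + ak (x) bk of an algebraic tensor product.  All the
   norms below depend only on the element and not on the chosen list. *)

Definition tensor (X Y : Type) : Type := seq (X * Y).

Definition mxtensor_in (R : realType) (H K : hilbertType R)
    (A : set (H -> H)) (E : set (K -> K)) (n : nat)
    (x : 'M[tensor (H -> H) (K -> K)]_n) : Prop :=
  forall i j p, p \in x i j -> A p.1 /\ E p.2.

(* The inner product of H (x) K on the algebraic tensor product. *)
Definition tinner (R : realType) (H K : hilbertType R) (u v : tensor H K) : R[i] :=
  \sum_(p <- u) \sum_(q <- v) inner p.1 q.1 * inner p.2 q.2.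

Definition tvecnorm (R : realType) (H K : hilbertType R) (n : nat)
    (v : 'I_n -> tensor H K) : R :=
  Num.sqrt (\sum_(i < n) complex.Re (tinner (v i) (v i))).

Definition tapply (R : realType) (H K : hilbertType R)
    (x : tensor (H -> H) (K -> K)) (v : tensor H K) : tensor H K :=
  [seq (p.1 q.1, p.2 q.2) | p <- x, q <- v].

(* The i-th entry \sum_j x_ij v_j of x v. *)
Definition mxtapply (R : realType) (H K : hilbertType R) (n : nat)
    (x : 'M[tensor (H -> H) (K -> K)]_n) (v : 'I_n -> tensor H K) :
    'I_n -> tensor H K :=
  fun i => \big[cat/[::]]_(j < n) tapply (x i j) (v j).

(* The norm of M_n(B(H (x) K)).  The supremum is over the n-tuples of vectors of
   the algebraic tensor product of H and K, which are dense in (H (x) K)^n. *)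
Definition minnorm (R : realType) (H K : hilbertType R) (n : nat)
    (x : 'M[tensor (H -> H) (K -> K)]_n) : \bar R :=
  ereal_sup [set (tvecnorm (mxtapply x v))%:E
            | v in [set v : 'I_n -> tensor H K | tvecnorm v <= 1]].

Definition prod_rep (R : realType) (H K L : hilbertType R)
    (pi : (H -> H) -> (L -> L)) (rho : (K -> K) -> (L -> L))
    (x : tensor (H -> H) (K -> K)) : L -> L :=
  \sum_(p <- x) (pi p.1 \o rho p.2).

Definition commuting_reps (R : realType) (H K L : hilbertType R)
    (A : set (H -> H)) (E : set (K -> K))
    (pi : (H -> H) -> (L -> L)) (rho : (K -> K) -> (L -> L)) : Prop :=
  [/\ cc_representation A pi, cc_representation E rho &
      forall a b, A a -> E b -> pi a \o rho b = rho b \o pi a].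

Definition maxnorm (R : realType) (H K : hilbertType R)
    (A : set (H -> H)) (E : set (K -> K)) (n : nat)
    (x : 'M[tensor (H -> H) (K -> K)]_n) : \bar R :=
  ereal_sup [set r | exists (L : hilbertType R)
      (pi : (H -> H) -> (L -> L)) (rho : (K -> K) -> (L -> L)),
      commuting_reps A E pi rho /\ r = mxopnorm (map_mx (prod_rep pi rho) x)].

(* The identity of the algebraic tensor product, which is dense in both
   completions, extends to a completely isometric isomorphism if and only if it
   preserves the norms of matrices of all sizes. *)
Definition min_eq_max (R : realType) (H K : hilbertType R)
    (A : set (H -> H)) (E : set (K -> K)) : Prop :=
  forall (n : nat) (x : 'M[tensor (H -> H) (K -> K)]_n),
    mxtensor_in A E x -> minnorm x = maxnorm A E x.

Definition nuclear (R : realType) (K : hilbertType R) (D : set (K -> K)) : Prop :=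
  forall (L : hilbertType R) (B : set (L -> L)),
    cstar_algebra B -> min_eq_max D B.

(* Main.v *)
Require Import Defs.
From HB Require Import structures.
From mathcomp Require Import all_boot all_order all_algebra.
From mathcomp Require Import complex.
From mathcomp Require Import all_classical all_reals all_analysis.
From mathcomp Require Import ring lra.

Set Implicit Arguments.
Unset Strict Implicit.
Unset Printing Implicit Defensive.

(** Adjoin a unit to [D]: on the Hilbert space [K] of [D] let [D1 = D + C 1].
    Because [D] is not unital, [1] is not in [D], and [D1] is a unital C*-algebra
    that contains [D] as an ideal and has a character [chi] with kernel [D]
    ([character_contractive], [cstar_unitization]).  The hypothesis on [A] applies
    to [D1], so everything follows from one equivalence, valid for every operator
    algebra [B] ([min_eq_max_unitization]): the minimal and maximal norms agree on
    [B (x) D] if and only if they agree on [B (x) D1].  With [B = A] it transfers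
    the equality for [A]; with [B] an arbitrary C*-algebra, and the two factors
    exchanged ([min_eq_max_swap]), it says that [D] is nuclear if and only if [D1]
    is.

    From [D1] to [D], minimal norms are the same by definition.  Maximal norms are
    the same because a completely contractive representation [rho] of [D] extends
    to [D1] by sending 1 to 1; the extension commutes with whatever commutes with
    [rho], and it is again completely contractive ([rep_unitizationP]).

    From [D] to [D1], the principle is that an element [x] of [M_n(B (x) D1)] is
    controlled by two things: the products [x (1 (x) e)] with [e] in the unit ball
    of [D], which lie in [M_n(B (x) D)] where the norms are supposed to agree, and
    the slice [(1 (x) chi)(x)] in [M_n(B)].  A representation of [D] on [L] splits
    [L] orthogonally into the closure of [rho(D) L], on which an approximate unit
    converges strongly to 1, and the common kernel of [rho(D)], on which [D1] acts
    through [chi] ([essential_dec], [ker_orth_essential]).  An operator matrix that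
    respects the splitting is bounded by the larger of its two restrictions
    ([matrix_bound_glue]).  Applied to the space of a commuting pair of
    representations this gives [max <= min] ([maxnorm_le_minnorm]); applied to [K]
    itself, as the second factor of [H (x) K], it gives [min <= max]
    ([minnorm_le_maxnorm]).  The slice is at most the minimal norm by a vector
    state computation ([slice_map_bound]), and at most the maximal norm because
    the inclusion of [B] and the scalar representation [chi] form a commuting pair
    ([character_rep]).

    Norms of algebraic tensors are computed by expanding the first factors of the
    finitely many elementary tensors involved in an orthonormal family
    ([tvecnorm_parseval]); this turns operators [1 (x) T] into diagonal ones
    ([tvecnorm_amplify]).  The approximate unit of [D] is made of polynomials
    [1 - (1 - h)^k] in positive elements [h] ([right_approx_unit]). *)

Import Order.TTheory GRing.Theory Num.Theory Num.Def.
Import numFieldNormedType.Exports.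

Local Open Scope classical_set_scope.
Local Open Scope ring_scope.
Local Open Scope complex_scope.

Local Notation Re := complex.Re.
Local Notation Im := complex.Im.

(** * Inner products and norms *)

Section Inner.
Context {R : realType} {V : hilbertType R}.
Implicit Types (x y z : V) (c : R[i]).

Lemma innerDl x y z : inner (x + y) z = inner x z + inner y z.
Proof. by rewrite linearDl. Qed.

Lemma innerDr x y z : inner x (y + z) = inner x y + inner x z.
Proof. by rewrite linearDr. Qed.

Lemma innerZl c x y : inner (c *: x) y = c * inner x y.
Proof. by rewrite linearZl_LR. Qed.

Lemma innerZr c x y : inner x (c *: y) = conjc c * inner x y.
Proof. by rewrite linearZr_LR. Qed.

Lemma innerNr x y : inner x (- y) = - inner x y.
Proof. by rewrite linearNr. Qed.

Lemma innerBl x y z : inner (x - y) z = inner x z - inner y z.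
Proof. by rewrite linearBl. Qed.

Lemma innerBr x y z : inner x (y - z) = inner x y - inner x z.
Proof. by rewrite linearBr. Qed.

Lemma inner0l x : inner 0 x = 0.
Proof. by rewrite linear0l. Qed.

Lemma inner0r x : inner x 0 = 0.
Proof. by rewrite linear0r. Qed.

Lemma inner_suml I (r : seq I) P (F : I -> V) x :
  inner (\sum_(i <- r | P i) F i) x = \sum_(i <- r | P i) inner (F i) x.
Proof. by rewrite linear_sumlz. Qed.

Lemma inner_sumr I (r : seq I) P (F : I -> V) x :
  inner x (\sum_(i <- r | P i) F i) = \sum_(i <- r | P i) inner x (F i).
Proof. by rewrite linear_sumr. Qed.

Lemma innerC x y : inner x y = conjc (inner y x).
Proof. by rewrite hermitian_subproof expr0 mul1r; reflexivity. Qed.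

Lemma Re_inner_sym x y : Re (inner x y) = Re (inner y x).
Proof. by rewrite innerC; case: (inner y x) => a b; reflexivity. Qed.

Lemma hnorm_ge0 x : 0 <= hnorm x.
Proof. by have := normr_ge0 x; rewrite lecE => /andP[]. Qed.

Lemma normE x : `|x| = (hnorm x)%:C.
Proof. by rewrite RRe_real// ger0_real. Qed.

Lemma innerE x : inner x x = (hnorm x ^+ 2)%:C.
Proof. by rewrite -sqr_normE normE rmorphXn. Qed.

Lemma hnorm_sqr x : hnorm x ^+ 2 = Re (inner x x).
Proof. by rewrite innerE. Qed.

Lemma hnormD_le x y : hnorm (x + y) <= hnorm x + hnorm y.
Proof. by have := ler_normD x y; rewrite !normE -rmorphD lecR. Qed.

Lemma hnorm_opp x : hnorm (- x) = hnorm x.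
Proof. by rewrite /hnorm normrN. Qed.

Lemma hnormB_le x y : hnorm (x - y) <= hnorm x + hnorm y.
Proof. by rewrite -(hnorm_opp y) hnormD_le. Qed.

Lemma hnorm_distC x y : hnorm (x - y) = hnorm (y - x).
Proof. by rewrite -hnorm_opp opprB. Qed.

Lemma hnorm0 : hnorm (0 : V) = 0.
Proof. by rewrite /hnorm normr0. Qed.

Lemma hnorm_eq0 x : hnorm x = 0 -> x = 0.
Proof. by move=> x0; apply/eqP; rewrite -normr_eq0 normE x0. Qed.

Lemma hnormZ c x : hnorm (c *: x) = Re `|c| * hnorm x.
Proof.
have /RRe_real cE : `|c| \is Num.real by rewrite ger0_real.
by rewrite /hnorm normrZ -cE [`|x|]normE -rmorphM.
Qed.

Lemma hnormZr (t : R) x : hnorm (t%:C *: x) = `|t| * hnorm x.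
Proof.
rewrite hnormZ; congr (_ * _).
by rewrite normc_def /= expr0n addr0 sqrtr_sqr.
Qed.

Lemma hnorm_sum I (r : seq I) P (F : I -> V) :
  hnorm (\sum_(i <- r | P i) F i) <= \sum_(i <- r | P i) hnorm (F i).
Proof.
elim/big_ind2 : _ => [|x a y b xa yb|i _//]; first by rewrite hnorm0.
by apply: le_trans (hnormD_le _ _) _; exact: lerD.
Qed.

Lemma hnormD_sqr x y :
  hnorm (x + y) ^+ 2 = hnorm x ^+ 2 + 2 * Re (inner x y) + hnorm y ^+ 2.
Proof.
rewrite !hnorm_sqr innerDl !innerDr !raddfD /= [Re (inner y x)]Re_inner_sym.
by ring.
Qed.

Lemma hnormD_orth x y : inner x y = 0 ->
  hnorm (x + y) ^+ 2 = hnorm x ^+ 2 + hnorm y ^+ 2.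
Proof. by move=> xy; rewrite hnormD_sqr xy mulr0 addr0. Qed.

End Inner.

(** Every Cauchy-Schwarz inequality below is an instance: the trinomial is the
    squared norm of [x - t y]. *)
Lemma quad_discr (R : realType) (a b c : R) : 0 <= c ->
  (forall t : R, 0 <= a - 2 * t * b + t ^+ 2 * c) -> b ^+ 2 <= a * c.
Proof.
rewrite le_eqVlt => /predU1P[<-|c0] h; last first.
  have := h (b / c).
  have -> : a - 2 * (b / c) * b + (b / c) ^+ 2 * c = (a * c - b ^+ 2) / c.
    by field; rewrite gt_eqF.
  by rewrite pmulr_lge0 ?invr_gt0// subr_ge0.
rewrite mulr0 le_eqVlt sqrf_eq0; have [//|b0] := eqVneq b 0.
have := h ((a + 1) / (2 * b)).
suff -> : a - 2 * ((a + 1) / (2 * b)) * b + ((a + 1) / (2 * b)) ^+ 2 * 0 = -1.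
  by rewrite ler0N1.
by field.
Qed.

Section CauchySchwarz.
Context {R : realType} {V : hilbertType R}.
Implicit Types (x y z : V).

Lemma Re_inner_le x y : Re (inner x y) <= hnorm x * hnorm y.
Proof.
suff h : Re (inner x y) ^+ 2 <= (hnorm x * hnorm y) ^+ 2.
  have [xy0|/ltW xy0] := leP (Re (inner x y)) 0.
    by apply: le_trans xy0 _; rewrite mulr_ge0 ?hnorm_ge0.
  by rewrite -ler_sqr ?nnegrE ?mulr_ge0 ?hnorm_ge0.
rewrite exprMn; apply: quad_discr => [|t]; first exact: sqr_ge0.
rewrite (_ : _ + _ = hnorm (x - t%:C *: y) ^+ 2) ?sqr_ge0//.
rewrite hnormD_sqr hnorm_opp innerNr hnormZr innerZr exprMn real_normK ?num_real//.
by case: (inner x y) => a b /=; ring.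
Qed.

(** The first-order condition at [c = 0]: the derivative of [|z + c w| ^+ 2] along
    real, then imaginary, [c] is twice the real, then imaginary, part of [<z, w>]. *)
Lemma orth_of_min z w :
  (forall c : R[i], hnorm z <= hnorm (z + c *: w)) -> inner z w = 0.
Proof.
have key (u : V) : (forall t : R, hnorm z <= hnorm (z + t%:C *: u)) ->
    Re (inner z u) = 0.
  move=> h; suff : Re (inner z u) ^+ 2 <= 0 * hnorm u ^+ 2.
    by rewrite mul0r le_eqVlt ltNge sqr_ge0 orbF sqrf_eq0 => /eqP.
  apply: quad_discr => [|t]; first exact: sqr_ge0.
  have := h (- t); rewrite -ler_sqr ?nnegrE ?hnorm_ge0// hnormD_sqr hnormZr.
  rewrite exprMn real_normK ?num_real// innerZr -addrA lerDl => /le_trans; apply.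
  rewrite le_eqVlt; apply/orP/or_introl/eqP.
  by case: (inner z u) => a b /=; ring.
move=> h; have Re0 := key w (fun t => h t%:C).
have : Re (inner z ('i *: w)) = 0 by apply: key => t; rewrite scalerA; exact: h.
rewrite innerZr; move: Re0; case: (inner z w) => a b /= ->.
by rewrite mul0r mulN1r opprK add0r => ->.
Qed.

End CauchySchwarz.

(** * Limits and bounded operators *)

Lemma lim_le (R : realType) (f g : nat -> R) a b :
  f @ \oo --> a -> g @ \oo --> b -> (forall n, f n <= g n) -> a <= b.
Proof. by move=> fa gb fg; apply: (ler_cvg_to fa gb); exact: nearW. Qed.

Section Topology.
Context {R : realType} {V : hilbertType R}.
Implicit Types (u : nat -> V) (l : V).

Lemma cvg_hnormP u l :
  (u @ \oo --> l) <-> ((fun n => hnorm (l - u n)) @ \oo --> (0 : R)).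
Proof.
split=> [/cvgrPdist_lt ul|/cvgrPdist_lt ul]; apply/cvgrPdist_lt => e e0.
  have := ul e%:C; rewrite ltcR => /(_ e0); apply: filterS => n /=.
  by rewrite normE ltcR sub0r normrN ger0_norm ?hnorm_ge0.
have eE : e = (Re e)%:C by rewrite RRe_real// gtr0_real.
have := ul (Re e); rewrite -ltcR -eE => /(_ e0); apply: filterS => n /=.
by rewrite sub0r normrN ger0_norm ?hnorm_ge0// normE [in X in _ -> X]eE ltcR.
Qed.

Lemma cvg_hnorm u l : u @ \oo --> l -> (fun n => hnorm (u n)) @ \oo --> hnorm l.
Proof.
move=> /cvg_hnormP ul; apply/cvgrPdist_le => e e0.
have /cvgrPdist_le /(_ e e0) := ul; apply: filterS => n /=.
rewrite sub0r normrN ger0_norm ?hnorm_ge0//; apply: le_trans.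
have h1 := hnormD_le (l - u n) (u n); rewrite subrK in h1.
have h2 := hnormD_le (u n - l) l; rewrite subrK hnorm_distC in h2.
by rewrite ler_norml; apply/andP; split; lra.
Qed.

Lemma cvg_hnorm_sqr u l :
  u @ \oo --> l -> (fun n => hnorm (u n) ^+ 2) @ \oo --> hnorm l ^+ 2.
Proof. by move=> /cvg_hnorm ul; rewrite expr2; exact: cvgM. Qed.

Lemma hilbert_complete u :
  (forall e : R, 0 < e -> exists N, forall m n, (N <= m)%N -> (N <= n)%N ->
     hnorm (u m - u n) < e) -> exists l, u @ \oo --> l.
Proof.
move=> cu; suff : cvg (u @ \oo) by move=> ?; exists (lim (u @ \oo)).
apply/cauchy_cvgP/cauchy_exP => e e0.
have eE : e = (Re e)%:C by rewrite RRe_real// gtr0_real.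
have := cu (Re e); rewrite -ltcR -eE => /(_ e0)[N hN].
exists (u N); exists N => // n /= Nn.
by rewrite -ball_normE /= normE [X in _ < X]eE ltcR hN.
Qed.

End Topology.

Section BoundedOp.
Context {R : realType} {V : hilbertType R}.
Implicit Types (T : V -> V) (c : R[i]).

Lemma bopD T : bounded_op T -> {morph T : x y / x + y}.
Proof. by move=> [lT _] x y; have := lT 1 x y; rewrite !scale1r. Qed.

Lemma bop0 T : bounded_op T -> T 0 = 0.
Proof. by move=> bT; apply: (addIr (T 0)); rewrite -bopD// !add0r. Qed.

Lemma bopZ T c x : bounded_op T -> T (c *: x) = c *: T x.
Proof. by move=> bT; have := bT.1 c x 0; rewrite !addr0 bop0// addr0. Qed.

Lemma bopN T : bounded_op T -> {morph T : x / - x}.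
Proof. by move=> bT x; rewrite -scaleN1r bopZ// scaleN1r. Qed.

Lemma bopB T : bounded_op T -> {morph T : x y / x - y}.
Proof. by move=> bT x y; rewrite bopD// bopN. Qed.

Lemma bop_sum T I (r : seq I) P (F : I -> V) : bounded_op T ->
  T (\sum_(i <- r | P i) F i) = \sum_(i <- r | P i) T (F i).
Proof. by move=> bT; apply: big_morph => [x y|]; [exact: bopD|exact: bop0]. Qed.

Lemma bop_cvg T (u : nat -> V) l : bounded_op T ->
  u @ \oo --> l -> (fun n => T (u n)) @ \oo --> T l.
Proof. by move=> [_ cT] ul; apply: continuous_cvg => //; exact: cT. Qed.

Lemma bop_bound T : bounded_op T ->
  exists2 C : R, 0 <= C & forall x, hnorm (T x) <= C * hnorm x.
Proof.
move=> [lT cT].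
pose f : {linear V -> V} := HB.pack T (GRing.isLinear.Build _ _ _ _ T lT).
have /linear_boundedP : bounded_near f (nbhs (0 : V)).
  by apply: continuous_linear_bounded; exact: cT.
move=> /pinfty_ex_gt0[M M0 hM].
have ME : M = (Re M)%:C by rewrite RRe_real// gtr0_real.
exists (Re M) => [|x]; first by rewrite -ler0c -ME ltW.
by have := hM x; rewrite [X in X <= _]normE [`|x|]normE ME -rmorphM lecR.
Qed.

Lemma bounded_opI T (C : R) : linear T ->
  (forall x, hnorm (T x) <= C * hnorm x) -> bounded_op T.
Proof.
move=> lT hT; split=> //.
pose f : {linear V -> V} := HB.pack T (GRing.isLinear.Build _ _ _ _ T lT).
apply: (@bounded_linear_continuous _ _ _ f).
apply/linear_boundedP; exists C%:C; split; first by rewrite complex_real.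
move=> r Cr x; rewrite [`|x|]normE [X in X <= _]normE.
have rE : r = (Re r)%:C.
  by move: Cr; rewrite ltcE; case: (r) => a b /= /andP[/eqP -> _].
move: Cr; rewrite rE ltcR => Cr; rewrite -rmorphM lecR.
by apply: le_trans (hT x) _; rewrite ler_wpM2r ?hnorm_ge0// ltW.
Qed.

Lemma bop_id : bounded_op (@id V).
Proof. by apply: (@bounded_opI _ 1) => // x; rewrite mul1r. Qed.

Lemma bop_zero : bounded_op (0 : V -> V).
Proof.
apply: (@bounded_opI _ 0) => [c x y|x].
  by rewrite /= (_ : forall z, (0 : V -> V) z = 0)// scaler0 addr0.
by rewrite mul0r (_ : forall z, (0 : V -> V) z = 0)// hnorm0.
Qed.

Lemma bop_comp S T : bounded_op S -> bounded_op T -> bounded_op (S \o T).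
Proof.
move=> [lS cS] [lT cT]; split; first by move=> c x y /=; rewrite lT lS.
by move=> x; apply: continuous_comp; [exact: cT|exact: cS].
Qed.

Lemma bop_add S T : bounded_op S -> bounded_op T -> bounded_op (S + T).
Proof.
move=> [lS cS] [lT cT]; split.
  by move=> c x y; rewrite !fctE lS lT scalerDr addrACA.
by move=> x; apply: continuousD; [exact: cS|exact: cT].
Qed.

Lemma bop_scale c T : bounded_op T -> bounded_op (c *: T).
Proof.
move=> [lT cT]; split.
  by move=> d x y; rewrite !fctE lT scalerDr !scalerA mulrC.
by move=> x; apply: (@continuousZl_tmp _ _ _ _ c) => //; exact: cT.
Qed.

End BoundedOp.

(** * Orthogonal projections, Riesz representation, orthonormal families *)

Section Projection.
Context {R : realType} {V : hilbertType R}.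
Implicit Types (x y z v w : V) (S : set V) (c : R[i]).

Definition seq_closure S : set V :=
  [set v | exists2 u : nat -> V, (forall n, S (u n)) & u @ \oo --> v].

Lemma inner_lim0 (u : nat -> V) v w :
  u @ \oo --> v -> (forall n, inner (u n) w = 0) -> inner v w = 0.
Proof.
move=> uv u0; set c := inner v w.
(* Pairing with [c *: w] turns the complex number [c] into [`|c| ^+ 2]. *)
have cE : Re (inner v (c *: w)) = Re c ^+ 2 + Im c ^+ 2.
  by rewrite innerZr -/c; case: (c) => a b /=; ring.
have le0 : Re (inner v (c *: w)) <= 0 * hnorm (c *: w).
  have /cvg_hnormP lim0 := uv.
  apply: (lim_le (cvg_cst _) (cvgM lim0 (cvg_cst (hnorm (c *: w))))) => n.
  have -> : inner v (c *: w) = inner (v - u n) (c *: w).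
    by rewrite innerBl [inner (u n) _]innerZr u0 mulr0 subr0.
  exact: Re_inner_le.
move: le0; rewrite mul0r cE => le0.
have Rc := sqr_ge0 (Re c); have Ic := sqr_ge0 (Im c).
apply/eqP; rewrite eq_complex /= -[Re c == 0]sqrf_eq0 -[Im c == 0]sqrf_eq0.
by apply/andP; split; apply/eqP; lra.
Qed.

(** The orthogonal projection: a minimizing sequence for the distance to [S] is
    Cauchy by the parallelogram identity, and its limit is a closest point. *)
Lemma projection S v : S 0 -> (forall x y, S x -> S y -> S (x + y)) ->
  (forall c x, S x -> S (c *: x)) ->
  exists2 p, seq_closure S p & forall s, S s -> inner (v - p) s = 0.
Proof.
move=> S0 SD SZ.
pose I := [set hnorm (v - s) ^+ 2 | s in S].
have I_inf : has_inf I.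
  by split; [exists (hnorm (v - 0) ^+ 2), 0|exists 0 => _ [s _ <-]; exact: sqr_ge0].
pose d := inf I.
have d_le s : S s -> d <= hnorm (v - s) ^+ 2.
  by move=> Ss; apply: ge_inf; [exact: I_inf.2|exists s].
have /choice[u hu] n : exists s, S s /\ hnorm (v - s) ^+ 2 < d + harmonic n.
  have [_ [s Ss <-] h] := inf_adherent (harmonic_gt0 n) I_inf.
  by exists s.
have uS n : S (u n) by case: (hu n).
have h0 := @cvg_harmonic R.
have [p up] : exists p : V, u @ \oo --> p.
  apply: (@hilbert_complete _ V u) => e e0.
  have /cvgrPdist_lt/(_ (e ^+ 2 / 4)) := h0.
  rewrite divr_gt0 ?exprn_gt0// => /(_ isT)[N _ hN].
  exists N => m n Nm Nn.
  have {}hN k : (N <= k)%N -> harmonic k < e ^+ 2 / 4.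
    by move=> /hN; rewrite sub0r normrN gtr0_norm ?harmonic_gt0.
  have hm := hN _ Nm; have hn := hN _ Nn.
  have um := (hu m).2; have un := (hu n).2.
  have mid := d_le _ (SZ (2^-1)%:C _ (SD _ _ (uS m) (uS n))).
  rewrite -ltr_sqr ?nnegrE ?hnorm_ge0 ?(ltW e0)//.
  (* The parallelogram identity for [v - u m] and [v - u n]; their midpoint is
     again the difference of [v] and an element of [S]. *)
  have par : hnorm (u m - u n) ^+ 2 = 2 * hnorm (v - u m) ^+ 2 +
      2 * hnorm (v - u n) ^+ 2
      - 4 * hnorm (v - (2^-1)%:C *: (u m + u n)) ^+ 2.
    have -> : u m - u n = (v - u n) + (-1) *: (v - u m).
      by rewrite scaleN1r opprB [RHS]addrC addrA subrK.
    have -> : v - (2^-1)%:C *: (u m + u n) =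
              (2^-1)%:C *: ((v - u n) + (v - u m)).
      rewrite [RHS]scalerDr !scalerBr addrACA -opprD -!scalerDr.
      rewrite [X in _ = X - _]scalerDr -scalerDl -rmorphD.
      rewrite (_ : 2^-1 + 2^-1 = 1 :> R); last by field.
      by rewrite rmorph1 scale1r [u n + _]addrC.
    rewrite hnormZr exprMn scaleN1r ger0_norm//.
    move: (v - u m) (v - u n) => a b.
    rewrite !hnormD_sqr innerNr hnorm_opp raddfN /=.
    by field.
  rewrite par; move: um un mid hm hn; move: (harmonic m) (harmonic n) => a b.
  by lra.
have close : hnorm (v - p) ^+ 2 <= d.
  apply: (@lim_le _ (fun n => hnorm (v - u n) ^+ 2) (fun n => d + harmonic n)).
  - by apply: cvg_hnorm_sqr; apply: cvgB => //; exact: cvg_cst.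
  - by rewrite -[X in _ --> X]addr0; apply: cvgD => //; exact: cvg_cst.
  - by move=> n; apply: ltW; case: (hu n).
exists p; first by exists u.
move=> s Ss; apply: orth_of_min => c.
rewrite -ler_sqr ?nnegrE ?hnorm_ge0//; apply: le_trans close _.
apply: (@lim_le _ (fun=> d) (fun n => hnorm (v - u n + c *: s) ^+ 2)).
- exact: cvg_cst.
- apply: cvg_hnorm_sqr; apply: cvgD; last exact: cvg_cst.
  by apply: cvgB => //; exact: cvg_cst.
- move=> n; have -> : v - u n + c *: s = v - (u n + (- c) *: s).
    by rewrite scaleNr opprD opprK addrA.
  by apply: d_le; apply: SD => //; exact: SZ.
Qed.

End Projection.

Section RieszParseval.
Context {R : realType} {V : hilbertType R}.
Implicit Types (x y z v w : V) (T : V -> V) (c : R[i]).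

Lemma inner_eq0 x : inner x x = 0 -> x = 0.
Proof.
rewrite innerE => /eqP; rewrite eq_complex /= sqrf_eq0 => /andP[/eqP x0 _].
exact: hnorm_eq0.
Qed.

(** The Riesz representative is a multiple of the component, orthogonal to the
    kernel, of any vector outside the kernel. *)
Lemma riesz T w : bounded_op T -> exists z, forall x, inner (T x) w = inner x z.
Proof.
move=> bT; pose S := [set x | inner (T x) w = 0].
have S0 : S 0 by rewrite /S /= bop0// inner0l.
have SD x y : S x -> S y -> S (x + y).
  by rewrite /S /= bopD// innerDl => -> ->; rewrite addr0.
have SZ c x : S x -> S (c *: x) by rewrite /S /= bopZ// innerZl => ->; rewrite mulr0.
have [all0|/existsNP[x0 x0S]] := pselect (forall x, S x).
  by exists 0 => x; rewrite inner0r; exact: all0.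
have [p [u uS up] horth] := projection x0 S0 SD SZ.
have Sp : S p by apply: (inner_lim0 (bop_cvg bT up)) => n; exact: uS.
set q := x0 - p in horth.
set b := inner (T q) w.
have b0 : b != 0.
  apply/eqP => b0; apply: x0S; rewrite -(subrK p x0); exact: SD.
have nq : inner q q != 0.
  by apply/eqP => /inner_eq0 q0; move: b0; rewrite /b q0 bop0// inner0l eqxx.
exists (conjc (b / inner q q) *: q) => x.
have := horth (x - (inner (T x) w / b) *: q).
rewrite /S /= bopB// innerBl bopZ// innerZl -/b divfK// subrr => /(_ erefl).
rewrite innerBr innerZr => /eqP; rewrite subr_eq0 => /eqP h.
have {}h : inner x q = inner (T x) w / b * inner q q.
  by rewrite innerC h rmorphM /= conjcK -innerC.
by rewrite innerZr conjcK h mulrCA divfK// divfK.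
Qed.

(** Orthonormality of [hs] is expressed by its reproducing its own elements: this
    is the form in which the induction uses it. *)
Lemma gram_schmidt (s : seq V) : exists hs : seq V,
  (forall x, x \in hs -> x = \sum_(h <- hs) inner x h *: h) /\
  (forall x, x \in s -> x = \sum_(h <- hs) inner x h *: h).
Proof.
elim: s => [|x s [hs [hsE sE]]]; first by exists [::].
set r := x - \sum_(h <- hs) inner x h *: h.
have [r0|r0] := eqVneq r 0.
  exists hs; split => // y; rewrite inE => /predU1P[->|/sE//].
  by apply/eqP; rewrite -subr_eq0 -/r r0.
have nr : hnorm r != 0 by apply: contra_neq r0; exact: hnorm_eq0.
pose h := (hnorm r)^-1%:C *: r.
have rE : r = (hnorm r)%:C *: h by rewrite scalerA -rmorphM divff// scale1r.
have hh : inner h h = 1.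
  by rewrite innerE hnormZr ger0_norm ?invr_ge0 ?hnorm_ge0// mulVf ?expr1n.
have ro g : g \in hs -> inner r g = 0.
  move=> /hsE gE; rewrite innerBl [in X in _ - X]inner_suml [X in inner x X]gE.
  rewrite inner_sumr -sumrB big1// => k _.
  by rewrite innerZl innerZr -innerC mulrC subrr.
have ho g : g \in hs -> inner h g = 0 by move=> /ro rg; rewrite innerZl rg mulr0.
have oh g : g \in hs -> inner g h = 0.
  by move=> /ho hg; rewrite innerC hg conjc0.
have spano y : y = \sum_(g <- hs) inner y g *: g -> inner y h = 0.
  move=> ->; rewrite inner_suml big_seq big1// => g /oh gh.
  by rewrite innerZl gh mulr0.
exists (h :: hs); split => y; rewrite inE => /predU1P[->|yin]; rewrite big_cons.
- rewrite hh scale1r big_seq big1 ?addr0// => g /ho ->.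
  by rewrite scale0r.
- by rewrite oh// scale0r add0r -hsE.
- have xE : x = r + \sum_(g <- hs) inner x g *: g by rewrite subrK.
  rewrite [LHS]xE; congr (_ + _).
  rewrite [X in inner X h]xE innerDl inner_suml [in X in _ + X]big_seq big1 => [|g /oh gh].
    by rewrite addr0 [X in inner X h]rE innerZl hh mulr1 -rE.
  by rewrite innerZl gh mulr0.
- by have yE := sE _ yin; rewrite spano// scale0r add0r.
Qed.

Lemma parseval (s : seq V) : exists hs : seq V, forall x y, x \in s ->
  inner x y = \sum_(h <- hs) inner x h * inner h y.
Proof.
have [hs [_ sE]] := gram_schmidt s; exists hs => x y /sE xE.
rewrite [X in inner X y]xE inner_suml.
by apply: eq_bigr => h _; rewrite innerZl.
Qed.

(** [|S v| ^+ 2 = <T (S v), v>]. *)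
Lemma adjoint_bound T S (C : R) : is_adjoint T S ->
  (forall v, hnorm (T v) <= C * hnorm v) -> forall v, hnorm (S v) <= C * hnorm v.
Proof.
move=> TS hT v.
have [Sv0|Sv0] := eqVneq (hnorm (S v)) 0.
  have C0 := le_trans (hnorm_ge0 _) (hT v).
  by rewrite Sv0.
have Svp : 0 < hnorm (S v) by rewrite lt_neqAle eq_sym Sv0 hnorm_ge0.
rewrite -(ler_pM2l Svp) -expr2 hnorm_sqr -TS.
apply: le_trans (Re_inner_le _ _) _.
by rewrite mulrA [_ * C]mulrC ler_wpM2r ?hnorm_ge0.
Qed.

End RieszParseval.

(** * Approximate units *)

Section PositiveContraction.
Context {R : realType} {V : hilbertType R} (g : V -> V).
Hypothesis gB : {morph g : x y / x - y}.
Hypothesis g_sa : is_adjoint g g.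
Hypothesis g_ge0 : forall v, 0 <= Re (inner (g v) v).
Hypothesis g_le1 : forall v, Re (inner (g v) v) <= hnorm v ^+ 2.

Let form_gap v : Re (inner (g (v - g v)) (v - g v)) =
  Re (inner (g v) v) - 2 * hnorm (g v) ^+ 2 + Re (inner (g (g v)) (g v)).
Proof.
rewrite gB innerBl !innerBr !raddfB /= [inner (g (g v)) v]g_sa.
rewrite !hnorm_sqr; ring.
Qed.

(** In operator form, [g ^+ 2 <= g]: this is the sum of [0 <= <g u, u>] for
    [u = v - g v] and of [<g w, w> <= |w| ^+ 2] for [w = g v]. *)
Lemma pos_contr_sqr v : hnorm (g v) ^+ 2 <= Re (inner (g v) v).
Proof. by have := g_ge0 (v - g v); have := g_le1 (g v); rewrite form_gap; lra. Qed.

Lemma pos_contr v : hnorm (g v) <= hnorm v.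
Proof.
rewrite -ler_sqr ?nnegrE ?hnorm_ge0//.
exact: le_trans (pos_contr_sqr v) (g_le1 v).
Qed.

Lemma pos_contr_iter m v : hnorm (iter m g v) <= hnorm v.
Proof. by elim: m => //= m; apply: le_trans; exact: pos_contr. Qed.

Let gap v := hnorm v ^+ 2 - Re (inner (g v) v).

Let gap_decr v : gap (g v) <= gap v.
Proof.
have := g_ge0 (v - g v); rewrite form_gap /gap.
have := sqr_ge0 (hnorm (v - g v)).
rewrite hnormD_sqr hnorm_opp innerNr raddfN /= Re_inner_sym; lra.
Qed.

(** Spectrally, [(1 - t) * t ^+ (2 * m) <= 1 / (m + 1)] for [t] between 0 and 1.
    Without spectral theory: the gaps decrease along the orbit of [v], and their
    sum is at most a telescoping sum. *)
Lemma pos_contr_gap m v :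
  m.+1%:R * (hnorm (iter m g v) ^+ 2 - Re (inner (g (iter m g v)) (iter m g v)))
  <= hnorm v ^+ 2.
Proof.
have step w : gap w + hnorm (g w) ^+ 2 <= hnorm w ^+ 2.
  by have := pos_contr_sqr w; rewrite /gap; lra.
suff : m.+1%:R * gap (iter m g v) + hnorm (iter m.+1 g v) ^+ 2 <= hnorm v ^+ 2.
  by rewrite -/(gap _); have := sqr_ge0 (hnorm (iter m.+1 g v)); lra.
elim: m => [|m IH]; first by rewrite mul1r; exact: step.
have h1 := step (iter m.+1 g v).
have h2 : m.+1%:R * gap (iter m.+1 g v) <= m.+1%:R * gap (iter m g v).
  by rewrite ler_pM2l ?ltr0n//; exact: gap_decr.
rewrite (iterS m.+1) -[m.+2%:R]natr1 mulrDl mul1r; lra.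
Qed.

End PositiveContraction.

Section OperatorAlgebra.
Context {R : realType} {V : hilbertType R} (A : set (V -> V)).
Hypothesis opA : operator_algebra A.
Implicit Types (a b : V -> V) (c : R[i]).

Lemma oaP a : A a -> bounded_op a. Proof. by move=> Aa; case: opA => + _ _ _ _; exact. Qed.
Lemma oa0 : A 0. Proof. by case: opA => _ []. Qed.
Lemma oaD a b : A a -> A b -> A (a + b). Proof. by case: opA => _ [_ +] _ _ _; exact. Qed.
Lemma oaZ c a : A a -> A (c *: a). Proof. by case: opA => _ _ + _ _; exact. Qed.
Lemma oaM a b : A a -> A b -> A (a \o b). Proof. by case: opA => _ _ _ + _; exact. Qed.
Lemma oaN a : A a -> A (- a). Proof. by rewrite -scaleN1r; exact: oaZ. Qed.
Lemma oaB a b : A a -> A b -> A (a - b).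
Proof. by move=> Aa Ab; apply: oaD => //; exact: oaN. Qed.

Lemma oa_sum (I : eqType) (r : seq I) (F : I -> V -> V) :
  (forall i, i \in r -> A (F i)) -> A (\sum_(i <- r) F i).
Proof.
move=> AF; rewrite big_seq; apply: (big_ind A) => //; first exact: oa0.
exact: oaD.
Qed.

End OperatorAlgebra.

Section ApproximateUnit.
Context {R : realType} {V : hilbertType R} (A : set (V -> V)).
Hypothesis csA : cstar_algebra A.
Implicit Types (a b d e : V -> V) (c : R[i]).

Let opA : operator_algebra A := csA.1.

Lemma bounds_sqr (s : seq (V -> V)) : (forall d, d \in s -> A d) ->
  exists2 M : R, 0 < M & forall v, \sum_(d <- s) hnorm (d v) ^+ 2 <= M * hnorm v ^+ 2.
Proof.
elim: s => [|d s IH] sA; first by exists 1 => // v; rewrite big_nil mul1r sqr_ge0.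
have [M M0 hM] := IH (fun b bs => sA b (@mem_behead _ (d :: s) b bs)).
have [C C0 hC] := bop_bound (oaP opA (sA d (mem_head _ _))).
exists (C ^+ 2 + M) => [|v]; first by rewrite ltr_wpDl ?sqr_ge0.
rewrite big_cons mulrDl lerD// -exprMn.
by rewrite ler_sqr ?nnegrE ?hnorm_ge0 ?mulr_ge0 ?hnorm_ge0.
Qed.

(** [e = 1 - g ^+ (2 * m)] with [g = 1 - h] and [h] the sum of the [d^* d],
    scaled into the unit interval. *)
Lemma right_approx_unit (s : seq (V -> V)) (eps : R) : 0 < eps ->
  (forall d, d \in s -> A d) ->
  exists e, [/\ A e, is_adjoint e e, (forall v, hnorm (e v) <= hnorm v) &
    forall d, d \in s -> forall v, hnorm (d v - d (e v)) <= eps * hnorm v].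
Proof.
move=> eps0 sA.
have [M M0 hM] := bounds_sqr sA.
have /choice[adj hadj] d : exists b, A d -> A b /\ is_adjoint d b.
  have [Ad|nAd] := pselect (A d); last by exists 0.
  by have [b Ab db] := csA.2 d Ad; exists b.
pose h : V -> V := (M^-1)%:C *: \sum_(d <- s) (adj d \o d).
have Ah : A h.
  apply: oaZ => //; apply: oa_sum => // d /sA Ad; apply: oaM => //.
  exact: (hadj d Ad).1.
have hE v : h v = (M^-1)%:C *: \sum_(d <- s) adj d (d v).
  by rewrite /h; congr (_ *: _); rewrite fct_sumE.
have adj_sym x y : inner (h x) y = (M^-1)%:C * \sum_(d <- s) inner (d x) (d y).
  rewrite hE innerZl inner_suml big_seq [in RHS]big_seq; congr (_ * _).
  apply: eq_bigr => d /sA Ad; rewrite innerC -(hadj d Ad).2.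
  by rewrite -innerC.
have h_sa : is_adjoint h h.
  move=> x y; rewrite adj_sym [RHS]innerC adj_sym rmorphM rmorph_sum.
  congr (_ * _); first by rewrite /= oppr0.
  by apply: eq_bigr => d _; rewrite [LHS]innerC.
have h_form v : Re (inner (h v) v) = M^-1 * \sum_(d <- s) hnorm (d v) ^+ 2.
  rewrite adj_sym.
  have -> : \sum_(d <- s) inner (d v) (d v) = (\sum_(d <- s) hnorm (d v) ^+ 2)%:C.
    by rewrite rmorph_sum; apply: eq_bigr => d _; rewrite innerE.
  by rewrite -rmorphM.
have bh := oaP opA Ah.
pose g (v : V) := v - h v.
have gB : {morph g : x y / x - y}.
  by move=> x y; rewrite /g bopB// !opprB addrACA [RHS]addrACA [- y - h x]addrC.
have g_sa : is_adjoint g g.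
  by move=> x y; rewrite /g innerBl innerBr h_sa.
have gE v : Re (inner (g v) v) = hnorm v ^+ 2 - Re (inner (h v) v).
  by rewrite /g innerBl raddfB /= hnorm_sqr.
have g_ge0 v : 0 <= Re (inner (g v) v).
  by rewrite gE h_form subr_ge0 mulrC ler_pdivrMr// mulrC.
have g_le1 v : Re (inner (g v) v) <= hnorm v ^+ 2.
  rewrite gE h_form gerBl mulr_ge0 ?invr_ge0 ?(ltW M0)//.
  by apply: sumr_ge0 => d _; exact: sqr_ge0.
have gi_sa k : is_adjoint (iter k g) (iter k g).
  by elim: k => // k IH x y; rewrite iterS g_sa IH -iterSr.
have giB k : {morph (iter k g) : x y / x - y}.
  by elim: k => // k IH x y; rewrite !iterS IH gB.
have Ae k : A (fun v => v - iter k g v).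
  elim: k => [|k IH].
    rewrite (_ : (fun _ => _) = 0); first exact: oa0.
    by apply/funext => v /=; rewrite subrr.
  rewrite (_ : (fun _ => _) = (fun v => v - iter k g v) + h - (h \o (fun v => v - iter k g v))).
    by apply: oaB => //; [exact: oaD|exact: oaM].
  apply/funext => v; rewrite /= !fctE /= bopB// {1}/g opprB opprB !addrA.
  by rewrite [RHS]addrAC addrK addrAC.
have [m hm] : exists m, M / m.+1%:R <= eps ^+ 2.
  have /archi_boundP := ltW (divr_gt0 M0 (exprn_gt0 2 eps0)).
  set m := Num.Def.archi_bound _ => hm; exists m.
  rewrite ler_pdivrMr ?ltr0n// mulrC -ler_pdivrMr ?exprn_gt0//.
  by apply: ltW; apply: lt_trans hm _; rewrite ltr_nat.
pose G v := iter m g (iter m g v).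
have GE v : Re (inner (G v) v) = hnorm (iter m g v) ^+ 2.
  by rewrite /G gi_sa hnorm_sqr.
have GB : {morph G : x y / x - y} by move=> x y; rewrite /G !giB.
exists (fun v => v - iter (m + m) g v); split => //.
- by move=> x y; rewrite innerBl innerBr gi_sa.
- move=> v; rewrite iterD -/(G v); apply: (@pos_contr _ _ (fun v => v - G v)).
  + by move=> x y; rewrite GB !opprB addrACA [RHS]addrACA [- y - G x]addrC.
  + by move=> x y; rewrite innerBl innerBr /G 2!gi_sa.
  + move=> x; rewrite innerBl raddfB /= GE -hnorm_sqr subr_ge0.
    rewrite ler_sqr ?nnegrE ?hnorm_ge0//; exact: pos_contr_iter.
  + by move=> x; rewrite innerBl raddfB /= GE -hnorm_sqr gerBl sqr_ge0.
- move=> d ds v; have bd := oaP opA (sA d ds).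
  (* [d - d e = d g ^+ (2 * m)]; half of the powers makes [d] small, since
     [|d x| ^+ 2 <= M <h x, x>], and the other half is a contraction. *)
  rewrite -bopB// opprB addrC subrK iterD.
  set w := iter m g v.
  have e0 := ltW eps0.
  rewrite -ler_sqr ?nnegrE ?hnorm_ge0 ?mulr_ge0 ?hnorm_ge0// exprMn.
  have wv : hnorm w ^+ 2 <= hnorm v ^+ 2.
    by rewrite ler_sqr ?nnegrE ?hnorm_ge0//; exact: pos_contr_iter.
  have := pos_contr_gap gB g_sa g_ge0 g_le1 m w.
  set x := iter m g w; rewrite gE h_form opprB addrC subrK => hx.
  have dx : hnorm (d x) ^+ 2 <= \sum_(d <- s) hnorm (d x) ^+ 2.
    by rewrite (big_rem d)//= lerDl sumr_ge0// => d' _; exact: sqr_ge0.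
  apply: le_trans dx _; apply: le_trans (ler_wpM2l (sqr_ge0 eps) wv).
  apply: le_trans (ler_wpM2r (sqr_ge0 _) hm).
  rewrite mulrAC ler_pdivlMr ?ltr0n// mulrC.
  by move: hx; rewrite mulrCA ler_pdivrMl.
Qed.

(** The same element works on the left: apply the right version to the adjoints
    as well and take adjoints, [e] being selfadjoint. *)
Lemma approx_unit (s : seq (V -> V)) (eps : R) : 0 < eps ->
  (forall d, d \in s -> A d) ->
  exists e, [/\ A e, (forall v, hnorm (e v) <= hnorm v),
    (forall d, d \in s -> forall v, hnorm (d v - d (e v)) <= eps * hnorm v) &
    (forall d, d \in s -> forall v, hnorm (d v - e (d v)) <= eps * hnorm v)].
Proof.
move=> eps0 sA.
have /choice[adj hadj] d : exists b, A d -> A b /\ is_adjoint d b.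
  have [Ad|nAd] := pselect (A d); last by exists 0.
  by have [b Ab db] := csA.2 d Ad; exists b.
have sA' d : d \in s ++ [seq adj d | d <- s] -> A d.
  by rewrite mem_cat => /orP[/sA//|/mapP[b /sA Ab ->]]; exact: (hadj b Ab).1.
have [e [Ae e_sa e1 he]] := right_approx_unit eps0 sA'.
exists e; split=> // d ds; first by apply: he; rewrite mem_cat ds.
have [Ab db] := hadj d (sA d ds).
apply: (@adjoint_bound _ _ (fun v => adj d v - adj d (e v))); last first.
  by apply: he; rewrite mem_cat map_f ?orbT.
move=> x y; rewrite innerBl innerBr; congr (_ - _).
  by rewrite innerC -db -innerC.
by rewrite innerC -db -innerC e_sa.
Qed.

End ApproximateUnit.

(** * Matrix norms and completely contractive representations *)

Lemma cvg_sum_seq (K : numFieldType) (W : pseudoMetricNormedZmodType K)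
    (I : eqType) (r : seq I) (F : I -> nat -> W) (l : I -> W) :
  (forall i, i \in r -> F i @ \oo --> l i) ->
  (fun n => \sum_(i <- r) F i n) @ \oo --> \sum_(i <- r) l i.
Proof.
elim: r => [_|i r IH Fl].
  rewrite big_nil; under eq_fun do rewrite big_nil; exact: cvg_cst.
rewrite big_cons; under eq_fun do rewrite big_cons.
apply: cvgD; first by apply: Fl; exact: mem_head.
by apply: IH => j jr; apply: Fl; rewrite inE jr orbT.
Qed.

Section SupHomogeneous.
Context {R : realType}.

(** The norms are suprema over unit balls of seminorms; a vector in the kernel
    of [g] may be scaled arbitrarily, so [f] vanishes there too. *)
Lemma ereal_sup_homogP (X : Type) (sc : R -> X -> X) (f g : X -> R) (M : R) :
  (forall x, 0 <= f x) -> (forall x, 0 <= g x) ->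
  (forall t x, 0 <= t -> f (sc t x) = t * f x) ->
  (forall t x, 0 <= t -> g (sc t x) = t * g x) -> 0 <= M ->
  (ereal_sup [set (f x)%:E | x in [set x | (g x <= 1)%R]] <= M%:E)%E <->
  (forall x, f x <= M * g x).
Proof.
move=> f0 g0 fZ gZ M0; split=> [h x|h]; last first.
  apply: ge_ereal_sup => _ [x /= gx <-]; rewrite lee_fin.
  by apply: le_trans (h x) _; rewrite ler_piMr.
have {}h y : g y <= 1 -> f y <= M.
  move=> gy; rewrite -lee_fin; apply: le_trans h.
  by apply: ereal_sup_ubound; exists y.
have [gx0|gx0] := eqVneq (g x) 0; last first.
  have gp : 0 < g x by rewrite lt_neqAle eq_sym gx0 g0.
  have := h (sc (g x)^-1 x); rewrite gZ ?invr_ge0// mulVf// => /(_ (lexx _)).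
  by rewrite fZ ?invr_ge0// ler_pdivrMl// mulrC.
rewrite gx0 mulr0 leNgt; apply/negP => fp.
have t0 : 0 <= (M + 1) / f x by rewrite divr_ge0 ?addr_ge0.
have := h (sc ((M + 1) / f x) x); rewrite gZ// gx0 mulr0 => /(_ ler01).
by rewrite fZ// divfK ?gt_eqF//; lra.
Qed.

(** Comparing extended reals by their real upper bounds turns every inequality
    of norms below into an implication between bounds of operators. *)
Lemma lee_realP (a b : \bar R) :
  (forall M : R, (b <= M%:E)%E -> (a <= M%:E)%E) -> (a <= b)%E.
Proof.
case: b => [r|_|h]; [by apply|exact: leey|].
case: a h => [r /(_ (r - 1))|/(_ 0)|//]; last first.
  by rewrite leNye => /(_ isT); rewrite leye_eq.
by rewrite leNye lee_fin => /(_ isT) r1; exfalso; move: r1; lra.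
Qed.

End SupHomogeneous.

Section MatrixNorm.
Context {R : realType} {V : hilbertType R}.
Implicit Types (M : R) (c : R[i]).

Lemma opnormP (T : V -> V) M : linear T -> 0 <= M ->
  (opnorm T <= M%:E)%E <-> (forall x, hnorm (T x) <= M * hnorm x).
Proof.
move=> lT; apply: (@ereal_sup_homogP _ _ (fun t x => t%:C *: x)).
- by move=> x; exact: hnorm_ge0.
- by move=> x; exact: hnorm_ge0.
- move=> t x t0; have T0 : T 0 = 0.
    by apply: (addrI (T 0)); have := lT 1 0 0; rewrite !scale1r !addr0.
  by have := lT t%:C x 0; rewrite !addr0 T0 addr0 => ->; rewrite hnormZr ger0_norm.
- by move=> t x t0; rewrite hnormZr ger0_norm.
Qed.

Variable n : nat.
Implicit Types (v w : 'I_n -> V) (T : 'M[V -> V]_n).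

Definition mxapp T v : 'I_n -> V := fun i => \sum_j T i j (v j).

Lemma vecnorm_sqr v : vecnorm v ^+ 2 = \sum_i hnorm (v i) ^+ 2.
Proof. by rewrite sqr_sqrtr// sumr_ge0// => i _; exact: sqr_ge0. Qed.

Lemma vecnorm_ge0 v : 0 <= vecnorm v.
Proof. exact: sqrtr_ge0. Qed.

Lemma vecnorm_le v w M : 0 <= M ->
  (vecnorm v <= M * vecnorm w) =
  (\sum_i hnorm (v i) ^+ 2 <= M ^+ 2 * \sum_i hnorm (w i) ^+ 2).
Proof.
move=> M0; rewrite -!vecnorm_sqr -exprMn.
by rewrite ler_sqr ?nnegrE ?mulr_ge0 ?vecnorm_ge0.
Qed.

Lemma vecnormZ (t : R) v : 0 <= t ->
  vecnorm (fun i => t%:C *: v i) = t * vecnorm v.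
Proof.
move=> t0; rewrite /vecnorm -[X in _ = X * _](ger0_norm t0) -sqrtr_sqr.
rewrite -sqrtrM ?sqr_ge0// mulr_sumr; congr Num.sqrt; apply: eq_bigr => i _.
by rewrite hnormZr exprMn real_normK ?num_real.
Qed.

Lemma vecnorm0 : vecnorm (fun _ : 'I_n => 0 : V) = 0.
Proof. by rewrite /vecnorm big1 ?sqrtr0// => i _; rewrite hnorm0 expr0n. Qed.

Lemma vecnorm_contr (e : V -> V) v : (forall x, hnorm (e x) <= hnorm x) ->
  vecnorm (fun i => e (v i)) <= vecnorm v.
Proof.
move=> e1; rewrite -[X in _ <= X]mul1r vecnorm_le// expr1n mul1r.
by apply: ler_sum => i _; rewrite ler_sqr ?nnegrE ?hnorm_ge0.
Qed.

Lemma vecnorm_cvg (u : nat -> 'I_n -> V) v :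
  (forall i, (fun k => u k i) @ \oo --> v i) ->
  (fun k => vecnorm (u k)) @ \oo --> vecnorm v.
Proof.
move=> uv; apply: continuous_cvg; first exact: sqrt_continuous.
by apply: cvg_sum_seq => i _; apply: cvg_hnorm_sqr.
Qed.

Lemma mxapp_cvg T (u : nat -> 'I_n -> V) v i :
  (forall i j, bounded_op (T i j)) -> (forall i, (fun k => u k i) @ \oo --> v i) ->
  (fun k => mxapp T (u k) i) @ \oo --> mxapp T v i.
Proof. by move=> bT uv; apply: cvg_sum_seq => j _; apply: bop_cvg. Qed.

Lemma mxopnormP T M : (forall i j, bounded_op (T i j)) -> 0 <= M ->
  (mxopnorm T <= M%:E)%E <-> (forall v, vecnorm (mxapp T v) <= M * vecnorm v).
Proof.
move=> bT; apply: (@ereal_sup_homogP _ _ (fun t v i => t%:C *: v i)).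
- by move=> v; exact: vecnorm_ge0.
- by move=> v; exact: vecnorm_ge0.
- move=> t v t0; rewrite -vecnormZ//; congr vecnorm; apply/funext => i.
  by rewrite scaler_sumr; apply: eq_bigr => j _; rewrite bopZ.
- by move=> t v t0; exact: vecnormZ.
Qed.

Lemma mxopnorm_ge0 T M : (forall i j, bounded_op (T i j)) ->
  (mxopnorm T <= M%:E)%E -> 0 <= M.
Proof.
move=> bT h; rewrite -lee_fin; apply: le_trans h.
apply: ereal_sup_ubound; exists (fun=> 0); first by rewrite /= vecnorm0.
rewrite (_ : (fun i => _) = (fun=> 0)) ?vecnorm0//.
by apply/funext => i; rewrite big1// => j _; exact: bop0.
Qed.

End MatrixNorm.

Lemma vecnorm1 (R : realType) (V : hilbertType R) (v : 'I_1 -> V) :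
  vecnorm v = hnorm (v ord0).
Proof. by rewrite /vecnorm big_ord1 sqrtr_sqr ger0_norm ?hnorm_ge0. Qed.

Section Representations.
Context {R : realType} {V L : hilbertType R} (A : set (V -> V)).
Context (pi : (V -> V) -> L -> L).
Hypothesis opA : operator_algebra A.
Hypothesis ccpi : cc_representation A pi.
Implicit Types (a b : V -> V) (c : R[i]) (M : R).

Lemma repP a : A a -> bounded_op (pi a).
Proof. by case: ccpi => + _ _ _ _; exact. Qed.
Lemma repD a b : A a -> A b -> pi (a + b) = pi a + pi b.
Proof. by case: ccpi => _ + _ _ _; exact. Qed.
Lemma repZ c a : A a -> pi (c *: a) = c *: pi a.
Proof. by case: ccpi => _ _ + _ _; exact. Qed.
Lemma repM a b : A a -> A b -> pi (a \o b) = pi a \o pi b.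
Proof. by case: ccpi => _ _ _ + _; exact. Qed.
Lemma repB a b : A a -> A b -> pi (a - b) = pi a - pi b.
Proof.
move=> Aa Ab; rewrite -scaleN1r repD ?repZ ?scaleN1r//; exact: (oaN opA).
Qed.

Lemma rep_sum (I : eqType) (r : seq I) (F : I -> V -> V) :
  (forall i, i \in r -> A (F i)) ->
  pi (\sum_(i <- r) F i) = \sum_(i <- r) pi (F i).
Proof.
elim: r => [_|i r IH AF].
  by rewrite !big_nil -[X in pi X](scale0r (0 : V -> V)) repZ ?scale0r//; exact: (oa0 opA).
have Ai : A (F i) by apply: AF; exact: mem_head.
have Ar j : j \in r -> A (F j) by move=> jr; apply: AF; rewrite inE jr orbT.
rewrite !big_cons repD ?IH//; exact: (oa_sum opA).
Qed.

Lemma rep_mx_bound n (T : 'M[V -> V]_n) M : (forall i j, A (T i j)) -> 0 <= M ->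
  (forall v, vecnorm (mxapp T v) <= M * vecnorm v) ->
  forall v, vecnorm (mxapp (map_mx pi T) v) <= M * vecnorm v.
Proof.
move=> AT M0 hT; apply/mxopnormP => //; first by move=> i j; rewrite mxE; exact: repP.
case: ccpi => _ _ _ _ /(_ n T AT) h; apply: le_trans h _.
by apply/mxopnormP => // i j; exact: (oaP opA).
Qed.

Lemma rep_bound a M : A a -> 0 <= M -> (forall v, hnorm (a v) <= M * hnorm v) ->
  forall v, hnorm (pi a v) <= M * hnorm v.
Proof.
move=> Aa M0 ha v.
have := @rep_mx_bound 1 (const_mx a) M _ M0.
have hT i j : A ((const_mx a : 'M[V -> V]_1) i j) by rewrite mxE.
move=> /(_ hT) h.
have := h _ (fun=> v); rewrite !vecnorm1 /mxapp big_ord1 !mxE; apply => w.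
by rewrite !vecnorm1 /mxapp big_ord1 mxE.
Qed.

End Representations.

(** * The essential subspace of a representation *)

Section EssentialSubspace.
Context {R : realType} {K L : hilbertType R} (D : set (K -> K)).
Context (rho : (K -> K) -> L -> L).
Hypothesis csD : cstar_algebra D.
Hypothesis ccrho : cc_representation D rho.
Implicit Types (d e : K -> K) (v w x y : L) (c : R[i]).

Let opD : operator_algebra D := csD.1.

Definition rep_span : set L := [set v | exists2 s : seq ((K -> K) * L),
  (forall p, p \in s -> D p.1) & v = \sum_(p <- s) rho p.1 p.2].

Definition essential : set L := seq_closure rep_span.

Definition rep_ker : set L := [set x | forall d, D d -> rho d x = 0].

Let bop_rho d : D d -> bounded_op (rho d). Proof. exact: (repP ccrho). Qed.

Lemma rep_contr e : D e -> (forall k, hnorm (e k) <= hnorm k) ->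
  forall v, hnorm (rho e v) <= hnorm v.
Proof.
move=> De e1 v; rewrite -[X in _ <= X]mul1r.
by apply: (rep_bound opD ccrho De ler01) => k; rewrite mul1r.
Qed.

Lemma rep_span_rho d v : D d -> rep_span (rho d v).
Proof.
move=> Dd; exists [:: (d, v)]; last by rewrite big_seq1.
by move=> p; rewrite inE => /eqP ->.
Qed.

Lemma rep_span0 : rep_span 0.
Proof. by exists [::]; rewrite ?big_nil. Qed.

Lemma rep_spanD x y : rep_span x -> rep_span y -> rep_span (x + y).
Proof.
move=> [s sD ->] [t tD ->]; exists (s ++ t); last by rewrite big_cat.
by move=> p; rewrite mem_cat => /orP[/sD|/tD].
Qed.

Lemma rep_spanZ c x : rep_span x -> rep_span (c *: x).
Proof.
move=> [s sD ->]; exists [seq (p.1, c *: p.2) | p <- s].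
  by move=> _ /mapP[p /sD Dp ->].
rewrite big_map scaler_sumr big_seq [RHS]big_seq; apply: eq_bigr => p ps /=.
by rewrite bopZ//; exact: bop_rho (sD _ ps).
Qed.

(** One element [e] serves finitely many vectors: each is within [eps] of a finite
    sum of [rho d y], and [e] is taken to be a left approximate unit for all the
    [d] that occur.  The three terms of the bound are the two approximation errors
    and the error on the finite sum. *)
Let essential_approx1 (vs : seq L) (eps : R) : 0 < eps ->
  (forall v, v \in vs -> essential v) ->
  exists e, [/\ D e, (forall k, hnorm (e k) <= hnorm k) &
    forall v, v \in vs -> hnorm (v - rho e v) <= 3 * eps].
Proof.
move=> eps0 vsE.
have /choice[s hs] v : exists s : seq ((K -> K) * L), essential v ->
    (forall p, p \in s -> D p.1) /\ hnorm (v - \sum_(p <- s) rho p.1 p.2) <= eps.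
  have [[u uS uv]|nv] := pselect (essential v); last by exists [::].
  have /cvg_hnormP/cvgrPdist_le/(_ _ eps0)[N _ /(_ N (leqnn _))] := uv.
  rewrite sub0r normrN ger0_norm ?hnorm_ge0// => huN.
  by have [s sD uE] := uS N; exists s => _; split => //; rewrite -uE.
pose W := 1 + \sum_(v <- vs) \sum_(p <- s v) hnorm p.2.
have W0 : 0 < W.
  rewrite ltr_pwDl// sumr_ge0// => v _; rewrite sumr_ge0// => p _.
  exact: hnorm_ge0.
have dsD d : d \in flatten [seq [seq p.1 | p <- s v] | v <- vs] -> D d.
  move=> /flatten_mapP[v vvs /mapP[p ps ->]].
  exact: (hs v (vsE v vvs)).1.
have [e [De e1 _ he]] := approx_unit csD (divr_gt0 eps0 W0) dsD.
exists e; split=> // v vvs; have [sD sv] := hs v (vsE v vvs).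
set w := \sum_(p <- s v) _ in sv.
have -> : v - rho e v = (v - w) + (w - rho e w) + (rho e (w - v)).
  by rewrite (bopB (bop_rho De)) [X in _ = X + _]addrA subrK addrA subrK.
have we : hnorm (w - rho e w) <= eps.
  have -> : w - rho e w = \sum_(p <- s v) (rho (p.1 - (e \o p.1)) p.2).
    rewrite {2}/w (bop_sum _ _ _ (bop_rho De)) -sumrB big_seq [RHS]big_seq.
    apply: eq_bigr => p /sD Dp.
    by rewrite (repB opD ccrho Dp (oaM opD De Dp)) (repM ccrho De Dp).
  apply: le_trans (hnorm_sum _ _ _) _.
  have : \sum_(p <- s v) hnorm p.2 <= W.
    rewrite /W (big_rem v)//= addrCA lerDl addr_ge0// sumr_ge0// => v' _.
    by apply: sumr_ge0 => p _; exact: hnorm_ge0.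
  move=> /(ler_wpM2l (ltW (divr_gt0 eps0 W0))); rewrite divfK ?gt_eqF//.
  apply: le_trans; rewrite mulr_sumr big_seq [X in _ <= X]big_seq.
  apply: ler_sum => p ps.
  apply: (rep_bound opD ccrho).
  - by apply: (oaB opD); [exact: sD|apply: (oaM opD) => //; exact: sD].
  - by rewrite ltW// divr_gt0.
  - move=> k; apply: he; apply/flatten_mapP; exists v => //.
    by apply/mapP; exists p.
apply: le_trans (hnormD_le _ _) _.
have := rep_contr De e1 (w - v); rewrite hnorm_distC in sv.
have := hnormD_le (v - w) (w - rho e w); rewrite [hnorm (v - w)]hnorm_distC; lra.
Qed.

Lemma essential_approx (vs : seq L) : (forall v, v \in vs -> essential v) ->
  exists2 e : nat -> K -> K,
    (forall k, D (e k) /\ forall h, hnorm (e k h) <= hnorm h) &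
    forall v, v \in vs -> (fun k => rho (e k) v) @ \oo --> v.
Proof.
move=> vsE.
have /choice[e he] k := essential_approx1 (harmonic_gt0 k) vsE.
exists e => [k|v vvs]; first by have [] := he k.
apply/cvg_hnormP.
have h3 : (fun k => 3 * harmonic k : R) @ \oo --> (0 : R).
  rewrite -[X in _ --> X](mulr0 3); apply: cvgM; first exact: cvg_cst.
  exact: cvg_harmonic.
apply: (squeeze_cvgr _ (cvg_cst 0) h3); apply: nearW => k.
by rewrite hnorm_ge0 /=; have [_ _] := he k; apply.
Qed.

(** A substitute for the invariance of an orthogonal complement under adjoints.
    Let [z] represent [x |-> <rho d x, rho d w>].  If [d e] is close to [d], then
    [|z| ^+ 2] is close to [<rho e z, z> = <rho e z, z + c w>], because
    [rho e z] lies in the span; as [rho e] is a contraction, [|z| <= |z + c w|]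
    for all [c].  Hence [z] is orthogonal to [w], that is [rho d w = 0]. *)
Lemma orth_span_ker w : (forall s, rep_span s -> inner w s = 0) -> rep_ker w.
Proof.
move=> wS d Dd; set u := rho d w.
have [z hz] := riesz u (bop_rho Dd).
suff zw : inner z w = 0.
  by apply: inner_eq0; rewrite -/u [LHS]hz innerC zw conjc0.
apply: orth_of_min => c; set x := z + c *: w.
have [z0|z0] := eqVneq (hnorm z) 0; first by rewrite z0 hnorm_ge0.
have zp : 0 < hnorm z by rewrite lt_neqAle eq_sym z0 hnorm_ge0.
rewrite -(ler_pM2l zp) -expr2; apply/ler_addgt0Pr => eps eps0.
have B0 : 0 < hnorm z * hnorm u + 1.
  by rewrite ltr_wpDl// mulr_ge0 ?hnorm_ge0.
have [e [De e1 he _]] : exists e, [/\ D e, (forall k, hnorm (e k) <= hnorm k),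
    (forall d', d' \in [:: d] -> forall k, hnorm (d' k - d' (e k)) <=
       eps / (hnorm z * hnorm u + 1) * hnorm k) &
    (forall d', d' \in [:: d] -> forall k, hnorm (d' k - e (d' k)) <=
       eps / (hnorm z * hnorm u + 1) * hnorm k)].
  apply: approx_unit => //; first exact: divr_gt0.
  by move=> d'; rewrite inE => /eqP ->.
have Dde : D (d - (d \o e)) by apply: (oaB opD) => //; exact: (oaM opD).
have rde := rep_bound opD ccrho Dde (ltW (divr_gt0 eps0 B0)) (he d (mem_head _ _)).
have -> : hnorm z ^+ 2 = Re (inner (rho e z) x) + Re (inner (rho (d - (d \o e)) z) u).
  rewrite hnorm_sqr -hz (repB opD ccrho Dd (oaM opD Dd De)) (repM ccrho Dd De).
  rewrite [X in _ + Re X]innerBl raddfB /= [in X in _ - X]hz.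
  rewrite innerDr innerZr [inner (rho e z) w]innerC wS; last exact: rep_span_rho.
  by rewrite conjc0 mulr0 addr0 addrC subrK.
apply: lerD.
  apply: le_trans (Re_inner_le _ _) _.
  by rewrite ler_wpM2r ?hnorm_ge0//; exact: rep_contr.
apply: le_trans (Re_inner_le _ _) _.
apply: le_trans (ler_wpM2r (hnorm_ge0 u) (rde z)) _.
rewrite -mulrA mulrAC ler_pdivrMr// ler_wpM2l ?(ltW eps0)//; lra.
Qed.

Lemma essential_dec v : exists2 p, essential p & rep_ker (v - p).
Proof.
have [p pE horth] := projection v rep_span0 rep_spanD rep_spanZ.
by exists p => //; exact: orth_span_ker.
Qed.

(** The projection of [x] to the essential subspace is still killed by [D], while
    an approximate unit fixes it in the limit; so it is 0. *)
Lemma ker_orth_span x s : rep_ker x -> rep_span s -> inner x s = 0.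
Proof.
move=> xk; have [p pE horth] := projection x rep_span0 rep_spanD rep_spanZ.
have pk : rep_ker p.
  move=> d Dd; have := orth_span_ker horth Dd.
  by rewrite (bopB (bop_rho Dd)) xk// sub0r => /eqP; rewrite oppr_eq0 => /eqP.
suff p0 : p = 0 by rewrite p0 subr0 in horth; exact: horth.
have [v|e he hp] := @essential_approx [:: p].
  by rewrite inE => /eqP ->.
apply: hnorm_eq0; have /cvg_hnorm := hp p (mem_head _ _).
rewrite (_ : (fun k => hnorm (rho (e k) p)) = fun=> 0); last first.
  by apply/funext => k; rewrite pk ?hnorm0//; exact: (he k).1.
move=> h; apply/le_anti; rewrite hnorm_ge0 andbT.
exact: (lim_le h (cvg_cst 0)).
Qed.

Lemma ker_orth_essential x y : rep_ker x -> essential y -> inner y x = 0.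
Proof.
move=> xk [u uS uy]; apply: (inner_lim0 uy) => k.
by rewrite innerC ker_orth_span ?conjc0.
Qed.

(** The decomposition of the space into the essential subspace and the kernel is
    orthogonal and [T] respects it, so it suffices to bound [T] on each summand;
    on the essential subspace, vectors are limits of [rho e v]. *)
Lemma matrix_bound_glue n (T : 'M[L -> L]_n) (M : R) : 0 <= M ->
  (forall i j, bounded_op (T i j)) ->
  (forall i j d y x, D d -> rep_ker x -> inner (T i j (rho d y)) x = 0) ->
  (forall i j x, rep_ker x -> rep_ker (T i j x)) ->
  (forall e (v : 'I_n -> L), D e -> (forall k, hnorm (e k) <= hnorm k) ->
     vecnorm (mxapp T (fun i => rho e (v i))) <= M * vecnorm v) ->
  (forall v : 'I_n -> L, (forall i, rep_ker (v i)) -> vecnorm (mxapp T v) <= M * vecnorm v) ->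
  forall v : 'I_n -> L, vecnorm (mxapp T v) <= M * vecnorm v.
Proof.
move=> M0 bT Tess Tker hess hker v.
have /choice[P hP] x : exists p, essential p /\ rep_ker (x - p).
  by have [p] := essential_dec x; exists p.
pose v1 i := P (v i); pose v0 i := v i - P (v i).
have vE i : v i = v1 i + v0 i by rewrite addrC subrK.
have Tv i : mxapp T v i = mxapp T v1 i + mxapp T v0 i.
  rewrite /mxapp -big_split; apply: eq_bigr => j _ /=.
  by rewrite -bopD// -vE.
have ker0 i : rep_ker (v0 i) by exact: (hP (v i)).2.
have kerT i : rep_ker (mxapp T v0 i).
  move=> d Dd; rewrite /mxapp (bop_sum _ _ _ (bop_rho Dd)) big1// => j _.
  exact: Tker.
have orthT i : inner (mxapp T v1 i) (mxapp T v0 i) = 0.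
  rewrite [X in inner X _]/mxapp inner_suml big1// => j _.
  have [u uS uv] := (hP (v j)).1.
  apply: (inner_lim0 (bop_cvg (bT i j) uv)) => k.
  have [s sD ->] := uS k; rewrite (bop_sum _ _ _ (bT i j)) inner_suml big_seq big1// => p ps.
  by apply: Tess => //; exact: sD.
have b0 : vecnorm (mxapp T v0) <= M * vecnorm v0 by exact: hker.
have b1 : vecnorm (mxapp T v1) <= M * vecnorm v1.
  have [w|e he hw] := @essential_approx [seq v1 i | i <- enum 'I_n].
    by move=> /mapP[i _ ->]; exact: (hP (v i)).1.
  have ev i : (fun k => rho (e k) (v1 i)) @ \oo --> v1 i.
    by apply: hw; apply: map_f; rewrite mem_enum.
  apply: (@lim_le _ (fun k => vecnorm (mxapp T (fun i => rho (e k) (v1 i))))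
    (fun=> M * vecnorm v1)).
  - by apply: vecnorm_cvg => i; apply: mxapp_cvg.
  - exact: cvg_cst.
  - by move=> k; have [Dek ek1] := he k; exact: hess.
rewrite !vecnorm_le// in b0 b1 *.
rewrite (eq_bigr (fun i => hnorm (mxapp T v1 i) ^+ 2 + hnorm (mxapp T v0 i) ^+ 2)); last first.
  by move=> i _; rewrite Tv hnormD_orth.
rewrite [in X in _ <= X](eq_bigr (fun i => hnorm (v1 i) ^+ 2 + hnorm (v0 i) ^+ 2)); last first.
  move=> i _; rewrite {1}vE hnormD_orth//.
  by apply: ker_orth_essential => //; exact: (hP (v i)).1.
by rewrite !big_split /= mulrDr lerD.
Qed.

End EssentialSubspace.

(** * Algebraic tensors and the minimal norm *)

Section Tensor.
Context {R : realType} {H K : hilbertType R}.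
Implicit Types (u v w : tensor H K) (h : H) (k : K) (c : R[i]) (M : R).

(** The partial inner product [(<-, h> (x) 1) u]. *)
Definition slice h u : K := \sum_(p <- u) inner p.1 h *: p.2.

Lemma slice_cat h u v : slice h (u ++ v) = slice h u + slice h v.
Proof. exact: big_cat. Qed.

Lemma tinner_catl u v w : tinner (u ++ v) w = tinner u w + tinner v w.
Proof. exact: big_cat. Qed.

Lemma tinnerC u v : tinner u v = conjc (tinner v u).
Proof.
rewrite /tinner exchange_big rmorph_sum; apply: eq_bigr => p _ /=.
rewrite rmorph_sum; apply: eq_bigr => q _ /=.
by rewrite rmorphM /= -!innerC.
Qed.

Lemma tinner_catr u v w : tinner u (v ++ w) = tinner u v + tinner u w.
Proof. by rewrite tinnerC tinner_catl rmorphD /= -!tinnerC. Qed.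

Lemma tinner_single u h k : tinner u [:: (h, k)] = inner (slice h u) k.
Proof.
rewrite inner_suml; apply: eq_bigr => p _.
by rewrite big_seq1 innerZl.
Qed.

(** Expanding the first tensor factors in a common orthonormal family turns the
    norm of an algebraic tensor into a finite sum of squares of norms. *)
Lemma tinner_parseval (s : seq H) : exists hs : seq H, forall u,
  (forall p, p \in u -> p.1 \in s) ->
  tinner u u = (\sum_(h <- hs) hnorm (slice h u) ^+ 2)%:C.
Proof.
have [hs hsE] := parseval s; exists hs => u us.
rewrite rmorph_sum [RHS](eq_bigr (fun h => \sum_(p <- u) \sum_(q <- u)
    (inner p.1 h * inner h q.1 * inner p.2 q.2))); last first.
  move=> h _; transitivity (inner (slice h u) (slice h u)); first by rewrite innerE.
  rewrite inner_suml; apply: eq_bigr => p _.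
  rewrite innerZl inner_sumr mulr_sumr; apply: eq_bigr => q _.
  by rewrite innerZr -innerC mulrA.
rewrite exchange_big /tinner big_seq [RHS]big_seq; apply: eq_bigr => p pu.
rewrite exchange_big; apply: eq_bigr => q _.
by rewrite -mulr_suml -hsE// us.
Qed.

Lemma tinner_ge0 u : 0 <= Re (tinner u u).
Proof.
have [hs hsE] := tinner_parseval [seq p.1 | p <- u].
rewrite hsE => [|p pu]; last exact: map_f.
by apply: sumr_ge0 => h _; exact: sqr_ge0.
Qed.

Lemma tinnerD_sqr u v : Re (tinner (u ++ v) (u ++ v)) =
  Re (tinner u u) + 2 * Re (tinner u v) + Re (tinner v v).
Proof.
rewrite tinner_catl !tinner_catr [tinner v u]tinnerC !raddfD /=.
by case: (tinner u v) => a b /=; ring.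
Qed.

End Tensor.

Section TensorVectors.
Context {R : realType} {H K : hilbertType R} {n : nat}.
Implicit Types (u v w : 'I_n -> tensor H K) (h : H) (k : K) (c : R[i]) (M : R).

Lemma tvecnorm_ge0 v : 0 <= tvecnorm v.
Proof. exact: sqrtr_ge0. Qed.

Lemma tvecnorm_sqr v : tvecnorm v ^+ 2 = \sum_i Re (tinner (v i) (v i)).
Proof. by rewrite sqr_sqrtr// sumr_ge0// => i _; exact: tinner_ge0. Qed.

Lemma tvecnorm_parseval (s : seq H) : exists hs : seq H, forall v,
  (forall i p, p \in v i -> p.1 \in s) ->
  tvecnorm v ^+ 2 = \sum_(h <- hs) vecnorm (fun i => slice h (v i)) ^+ 2.
Proof.
have [hs hsE] := tinner_parseval s (K := K); exists hs => v vs.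
rewrite tvecnorm_sqr; under [RHS]eq_bigr do rewrite vecnorm_sqr.
rewrite exchange_big; apply: eq_bigr => i _ /=.
by rewrite hsE// => p; exact: vs.
Qed.

Definition first_factors v : seq H :=
  flatten [seq [seq p.1 | p <- v i] | i <- enum 'I_n].

Lemma first_factorsP v i p : p \in v i -> p.1 \in first_factors v.
Proof.
move=> pv; apply/flatten_mapP; exists i; first by rewrite mem_enum.
exact: map_f.
Qed.

(** The hypothesis says that [u = (1 (x) F) v]: in an orthonormal family of first
    factors, [F] acts on each coordinate of [v] separately. *)
Lemma tvecnorm_amplify (F : ('I_n -> K) -> 'I_n -> K) M u v : 0 <= M ->
  (forall y, vecnorm (F y) <= M * vecnorm y) ->
  (forall h i, slice h (u i) = F (fun j => slice h (v j)) i) ->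
  tvecnorm u <= M * tvecnorm v.
Proof.
move=> M0 hF uv.
have [hs hsE] := tvecnorm_parseval (first_factors u ++ first_factors v).
rewrite -ler_sqr ?nnegrE ?mulr_ge0 ?tvecnorm_ge0// exprMn.
rewrite !hsE; last 2 first.
  by move=> i p pv; rewrite mem_cat (first_factorsP pv) orbT.
  by move=> i p pu; rewrite mem_cat (first_factorsP pu).
rewrite mulr_sumr; apply: ler_sum => h _; rewrite -exprMn.
rewrite ler_sqr ?nnegrE ?mulr_ge0 ?vecnorm_ge0//.
by have -> : (fun i => slice h (u i)) = F (fun j => slice h (v j)) by apply/funext.
Qed.

Lemma tvecnormZ (t : R) v : 0 <= t ->
  tvecnorm (fun i => [seq (t%:C *: p.1, p.2) | p <- v i]) = t * tvecnorm v.
Proof.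
move=> t0; rewrite /tvecnorm -[X in _ = X * _](ger0_norm t0) -sqrtr_sqr.
rewrite -sqrtrM ?sqr_ge0// mulr_sumr; congr Num.sqrt; apply: eq_bigr => i _.
rewrite (_ : tinner _ _ = (t ^+ 2)%:C * tinner (v i) (v i)).
  by case: (tinner _ _) => a b /=; ring.
rewrite /tinner mulr_sumr big_map; apply: eq_bigr => p _.
rewrite mulr_sumr big_map; apply: eq_bigr => q _ /=.
by rewrite innerZl innerZr [conjc _]conjc_real mulrA -rmorphM -expr2 mulrA.
Qed.

Lemma tvecnorm_single (f : 'I_n -> H) k :
  tvecnorm (fun i => [:: (f i, k)]) = vecnorm f * hnorm k.
Proof.
apply/eqP; rewrite -(@eqrXn2 _ 2)// ?mulr_ge0 ?vecnorm_ge0 ?tvecnorm_ge0 ?hnorm_ge0//.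
rewrite exprMn tvecnorm_sqr vecnorm_sqr mulr_suml; apply/eqP.
apply: eq_bigr => i _; rewrite tinner_single /slice big_seq1 /= innerZl !innerE.
by rewrite -rmorphM.
Qed.

(** Cauchy-Schwarz in the Hilbert sum of [n] copies of [H (x) K], for [u] and the
    tuple of the [f i (x) z], where [z] is the sum itself. *)
Lemma slice_sum_le (f : 'I_n -> H) u :
  hnorm (\sum_i slice (f i) (u i)) <= vecnorm f * tvecnorm u.
Proof.
set z := \sum_i _.
have [z0|z0] := eqVneq (hnorm z) 0; first by rewrite z0 mulr_ge0 ?vecnorm_ge0 ?tvecnorm_ge0.
have zp : 0 < hnorm z by rewrite lt_neqAle eq_sym z0 hnorm_ge0.
suff : (hnorm z ^+ 2) ^+ 2 <= tvecnorm u ^+ 2 * (vecnorm f * hnorm z) ^+ 2.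
  have -> : tvecnorm u ^+ 2 * (vecnorm f * hnorm z) ^+ 2 =
            (vecnorm f * tvecnorm u * hnorm z) ^+ 2 by ring.
  rewrite ler_sqr ?nnegrE ?mulr_ge0 ?vecnorm_ge0 ?tvecnorm_ge0 ?hnorm_ge0//.
  by rewrite expr2 ler_pM2r.
apply: quad_discr => [|t]; first exact: sqr_ge0.
have -> : tvecnorm u ^+ 2 - 2 * t * hnorm z ^+ 2 + t ^+ 2 * (vecnorm f * hnorm z) ^+ 2 =
    \sum_i Re (tinner (u i ++ [:: ((- t)%:C *: f i, z)]) (u i ++ [:: ((- t)%:C *: f i, z)])).
  rewrite -tvecnorm_single !tvecnorm_sqr hnorm_sqr {2}/z inner_suml raddf_sum /=.
  rewrite !mulr_sumr -sumrB -big_split /=; apply: eq_bigr => i _.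
  rewrite tinnerD_sqr !tinner_single /slice !big_seq1 /= !innerZr !innerZl.
  have -> : inner (\sum_(p <- u i) inner p.1 ((- t)%:C *: f i) *: p.2) z =
     (- t)%:C * inner (\sum_(p <- u i) inner p.1 (f i) *: p.2) z.
    rewrite !inner_suml mulr_sumr; apply: eq_bigr => p _.
    by rewrite !innerZl innerZr [conjc _]conjc_real mulrA.
  rewrite !innerE [conjc _]conjc_real -!rmorphM /=.
  by case: (inner (\sum_(p <- u i) _) z) => a b /=; ring.
by apply: sumr_ge0 => i _; exact: tinner_ge0.
Qed.

End TensorVectors.

Section MinNorm.
Context {R : realType} {H K : hilbertType R} {n : nat}.
Implicit Types (x : 'M[tensor (H -> H) (K -> K)]_n) (v : 'I_n -> tensor H K).
Implicit Types (h : H) (k : K) (c : R[i]) (M : R).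

Lemma slice_tapply h (t : tensor (H -> H) (K -> K)) (u : tensor H K) :
  slice h (tapply t u) = \sum_(p <- t) \sum_(q <- u) inner (p.1 q.1) h *: p.2 q.2.
Proof. by rewrite /slice /tapply big_allpairs_dep. Qed.

Lemma slice_mxtapply h x v i :
  slice h (mxtapply x v i) = \sum_j slice h (tapply (x i j) (v j)).
Proof.
rewrite /mxtapply; apply: (big_morph _ (slice_cat h)).
by rewrite /slice big_nil.
Qed.

Lemma minnormP x M : (forall i j p, p \in x i j -> bounded_op p.1) -> 0 <= M ->
  (minnorm x <= M%:E)%E <-> (forall v, tvecnorm (mxtapply x v) <= M * tvecnorm v).
Proof.
move=> bx; apply: (@ereal_sup_homogP _ _
  (fun t v i => [seq (t%:C *: p.1, p.2) | p <- v i])).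
- by move=> v; exact: tvecnorm_ge0.
- by move=> v; exact: tvecnorm_ge0.
- move=> t v t0; rewrite -tvecnormZ//; congr tvecnorm; apply/funext => i.
  rewrite /mxtapply (big_morph _ (fun a b => map_cat _ a b) (erefl _)).
  apply: eq_bigr => j _; rewrite /tapply map_allpairs allpairs_mapr.
  apply/eq_in_allpairs => p q px _ /=; congr pair.
  by rewrite (bopZ _ _ (bx _ _ _ px)).
- by move=> t v t0; exact: tvecnormZ.
Qed.

Lemma tvecnorm0 : tvecnorm (fun _ : 'I_n => [::] : tensor H K) = 0.
Proof. by rewrite /tvecnorm big1 ?sqrtr0// => i _; rewrite /tinner big_nil. Qed.

Lemma minnorm_ge0 x M : (minnorm x <= M%:E)%E -> 0 <= M.
Proof.
move=> h; rewrite -lee_fin; apply: le_trans h.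
apply: le_trans (ereal_sup_ubound _); last first.
  by exists (fun=> [::]); [rewrite /= tvecnorm0|].
by rewrite lee_fin tvecnorm_ge0.
Qed.

(** Let [g] be the image of [f] under the sliced matrix.  Then [|g| ^+ 2] is the
    value of [chi] at one element [y] of [E], the slice of [x] by the vector
    functional of [f] and [g]; the norm of [y] is at most [|g| M |f|], and [chi] is
    contractive. *)
Lemma slice_map_bound (E : set (K -> K)) (chi : (K -> K) -> R[i]) x M :
  E 0 -> (forall a b, E a -> E b -> E (a + b)) -> (forall c a, E a -> E (c *: a)) ->
  (forall a b, E a -> E b -> chi (a + b) = chi a + chi b) ->
  (forall c a, E a -> chi (c *: a) = c * chi a) ->
  (forall a C, E a -> 0 <= C -> (forall k, hnorm (a k) <= C * hnorm k) ->
     Re (chi a) <= C) ->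
  (forall i j p, p \in x i j -> E p.2) -> 0 <= M ->
  (forall v, tvecnorm (mxtapply x v) <= M * tvecnorm v) ->
  forall f : 'I_n -> H, vecnorm (mxapp
    (\matrix_(i, j) \sum_(p <- x i j) (chi p.2 *: p.1)) f) <= M * vecnorm f.
Proof.
move=> E0 ED EZ chiD chiZ chi_le xE M0 hx f.
set g := mxapp _ _.
have gE i : g i = \sum_j \sum_(p <- x i j) chi p.2 *: p.1 (f j).
  by apply: eq_bigr => j _; rewrite mxE fct_sumE.
have [g0|g0] := eqVneq (vecnorm g) 0; first by rewrite g0 mulr_ge0 ?vecnorm_ge0.
have gp : 0 < vecnorm g by rewrite lt_neqAle eq_sym g0 vecnorm_ge0.
pose y : K -> K := \sum_i \sum_j \sum_(p <- x i j) inner (p.1 (f j)) (g i) *: p.2.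
have chi0 : chi 0 = 0 by rewrite -(scale0r (0 : K -> K)) chiZ// mul0r.
have sumE (I : eqType) (r : seq I) (F : I -> K -> K) :
    (forall i, i \in r -> E (F i)) ->
    E (\sum_(i <- r) F i) /\ chi (\sum_(i <- r) F i) = \sum_(i <- r) chi (F i).
  elim: r => [_|i r IH FE]; first by rewrite !big_nil.
  have Ei : E (F i) by apply: FE; exact: mem_head.
  have [|Er rE] := IH; first by move=> j jr; apply: FE; rewrite inE jr orbT.
  by rewrite !big_cons chiD// rE; split => //; exact: ED.
have s1 i j := sumE _ (x i j) (fun p => inner (p.1 (f j)) (g i) *: p.2)
  (fun p px => EZ _ _ (xE i j p px)).
have s2 i := sumE _ (index_enum 'I_n) _ (fun j _ => (s1 i j).1).
have [Ey chiy] := sumE _ (index_enum 'I_n) _ (fun i _ => (s2 i).1).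
have gy : vecnorm g ^+ 2 = Re (chi y).
  rewrite vecnorm_sqr chiy raddf_sum /=; apply: eq_bigr => i _.
  rewrite (s2 i).2 hnorm_sqr [X in inner X _]gE inner_suml; congr Re.
  apply: eq_bigr => j _; rewrite (s1 i j).2 inner_suml big_seq [RHS]big_seq.
  apply: eq_bigr => p px.
  by rewrite (chiZ _ _ (xE _ _ _ px)) innerZl mulrC.
have yk k : y k = \sum_i slice (g i) (mxtapply x (fun j => [:: (f j, k)]) i).
  rewrite /y fct_sumE; apply: eq_bigr => i _.
  rewrite fct_sumE slice_mxtapply; apply: eq_bigr => j _.
  rewrite fct_sumE slice_tapply; apply: eq_bigr => p _.
  by rewrite big_seq1.
rewrite -(ler_pM2l gp) -expr2 gy mulrA; apply: chi_le => //.
  by rewrite !mulr_ge0 ?vecnorm_ge0.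
move=> k; rewrite yk; apply: le_trans (slice_sum_le _ _) _.
rewrite -!mulrA ler_pM2l// -tvecnorm_single; exact: hx.
Qed.

End MinNorm.

(** * The unitization and its character *)

Section ComplexNorm.
Context {R : realType}.
Implicit Types (c : R[i]).

Lemma Re_le_norm c : Re c <= Re `|c|.
Proof.
have := normc_ge_Re c; rewrite lecE => /andP[_]; apply: le_trans.
exact: ler_norm.
Qed.

Lemma Re_normM c d : Re `|c * d| = Re `|c| * Re `|d|.
Proof. by rewrite normrM !normc_def -rmorphM. Qed.

Lemma Re_norm_le_add c : Re `|c| <= `|Re c| + `|Im c|.
Proof.
rewrite normc_def /= -ler_sqr ?nnegrE ?sqrtr_ge0 ?addr_ge0//.
rewrite sqr_sqrtr ?addr_ge0 ?sqr_ge0// sqrrD !real_normK ?num_real//.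
by rewrite lerD2r lerDl mulrn_wge0// mulr_ge0.
Qed.

Lemma real_complete (u : nat -> R) :
  (forall e : R, 0 < e -> exists N, forall m n, (N <= m)%N -> (N <= n)%N ->
     `|u m - u n| < e) -> exists l : R, u @ \oo --> l.
Proof.
move=> cu; suff : cvg (u @ \oo) by move=> ?; exists (lim (u @ \oo)).
apply/cauchy_cvgP/cauchy_exP => e e0; have [N hN] := cu e e0.
by exists (u N); exists N => // n /= Nn; rewrite /ball /= hN.
Qed.

End ComplexNorm.

Section Unitization.
Context {R : realType} {K : hilbertType R}.
Implicit Types (T S d a b : K -> K) (c : R[i]) (k : K).

Definition unitization (D : set (K -> K)) : set (K -> K) :=
  [set T | exists c, D (T - c *: (@id K))].

(** The quotient map onto [unitization D / D], the complex numbers. *)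
Definition character (D : set (K -> K)) T : R[i] :=
  xget 0 [set c | D (T - c *: (@id K))].

Context (D : set (K -> K)).
Hypothesis csD : cstar_algebra D.
Hypothesis nuD : ~ unital D.

Let opD : operator_algebra D := csD.1.
Let D1 := unitization D.
Let chi := character D.

Lemma nonunital_id : ~ D (@id K).
Proof.
move=> Did; apply: nuD; exists id; split => //.
by apply/opnormP => // k; rewrite mul1r.
Qed.

Lemma characterP T : D1 T -> D (T - chi T *: (@id K)).
Proof.
move=> [c hc].
exact: (@xgetPex _ 0 [set c : R[i] | D (T - c *: (@id K))] (ex_intro _ c hc)).
Qed.

Lemma character_uniq T c : D (T - c *: (@id K)) -> chi T = c.
Proof.
move=> hc; have hx := characterP (ex_intro _ c hc).
apply/eqP; rewrite -subr_eq0; apply/negPn/negP => cc0; apply: nonunital_id.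
have := oaZ opD (chi T - c)^-1 (oaB opD hc hx).
have -> : T - c *: (@id K) - (T - chi T *: (@id K)) = (chi T - c) *: (@id K).
  by rewrite opprB addrC addrA subrK scalerBl.
by rewrite scalerA mulVf// scale1r.
Qed.

Lemma unitization_sub T : D T -> D1 T.
Proof. by move=> DT; exists 0; rewrite scale0r subr0. Qed.

Lemma character_alg T : D T -> chi T = 0.
Proof. by move=> DT; apply: character_uniq; rewrite scale0r subr0. Qed.

Lemma unitization_id : D1 (@id K).
Proof. by exists 1; rewrite scale1r subrr; exact: (oa0 opD). Qed.

Lemma unitizationE T : D1 T -> T = (T - chi T *: (@id K)) + chi T *: (@id K).
Proof. by rewrite subrK. Qed.

Lemma unitization_bop T : D1 T -> bounded_op T.
Proof.
move=> DT; rewrite (unitizationE DT); apply: bop_add.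
  exact: (oaP opD (characterP DT)).
by apply: bop_scale; exact: bop_id.
Qed.

Let D1_add T S c (d : R[i]) : D (T - c *: (@id K)) -> D (S - d *: (@id K)) ->
  D (T + S - (c + d) *: (@id K)).
Proof.
by move=> hT hS; rewrite scalerDl opprD addrACA; exact: (oaD opD).
Qed.

Let D1_scale c T (d : R[i]) : D (T - d *: (@id K)) -> D (c *: T - (c * d) *: (@id K)).
Proof. by move=> hT; rewrite -scalerA -scalerBr; exact: (oaZ opD). Qed.

Let D1_mul T S c (d : R[i]) : D (T - c *: (@id K)) -> D (S - d *: (@id K)) ->
  D ((T \o S) - (c * d) *: (@id K)).
Proof.
move=> hT hS; set t := T - _ in hT; set s := S - _ in hS.
have -> : (T \o S) - (c * d) *: (@id K) = (t \o s) + (c *: s + d *: t).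
  have bt := oaP opD hT.
  have TE k : T k = t k + c *: k by rewrite /t !fctE subrK.
  have SE k : S k = s k + d *: k by rewrite /s !fctE subrK.
  apply/funext => k; rewrite !fctE /=; clearbody t s; rewrite TE SE (bopD bt) (bopZ _ _ bt) scalerDr scalerA.
  by rewrite addrA addrK -addrA [d *: _ + _]addrC.
by apply: (oaD opD); [exact: (oaM opD)|apply: (oaD opD); exact: (oaZ opD)].
Qed.

Lemma unitizationD T S : D1 T -> D1 S -> D1 (T + S).
Proof. by move=> [c hc] [d hd]; exists (c + d); exact: D1_add. Qed.

Lemma unitizationZ c T : D1 T -> D1 (c *: T).
Proof. by move=> [d hd]; exists (c * d); exact: D1_scale. Qed.

Lemma unitizationM T S : D1 T -> D1 S -> D1 (T \o S).
Proof. by move=> [c hc] [d hd]; exists (c * d); exact: D1_mul. Qed.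

Lemma characterD T S : D1 T -> D1 S -> chi (T + S) = chi T + chi S.
Proof. by move=> hT hS; apply/character_uniq/D1_add; exact: characterP. Qed.

Lemma characterZ c T : D1 T -> chi (c *: T) = c * chi T.
Proof. by move=> hT; apply/character_uniq/D1_scale; exact: characterP. Qed.

Lemma characterM T S : D1 T -> D1 S -> chi (T \o S) = chi T * chi S.
Proof. by move=> hT hS; apply/character_uniq/D1_mul; exact: characterP. Qed.

Lemma unitization_ideall T d : D1 T -> D d -> D (T \o d).
Proof.
move=> DT Dd; have := characterP (unitizationM DT (unitization_sub Dd)).
by rewrite (characterM DT (unitization_sub Dd)) (character_alg Dd) mulr0 scale0r subr0.
Qed.

Lemma unitization_idealr T d : D1 T -> D d -> D (d \o T).
Proof.
move=> DT Dd; have := characterP (unitizationM (unitization_sub Dd) DT).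
by rewrite (characterM (unitization_sub Dd) DT) (character_alg Dd) mul0r scale0r subr0.
Qed.

(** If [|chi T|] exceeded the bound [C], the powers of [y = T / chi T] would tend
    to 0 while [1 - y ^+ m] stays in the ideal [D]; being closed, [D] would
    contain 1. *)
Lemma character_contractive T (C : R) : D1 T -> 0 <= C ->
  (forall k, hnorm (T k) <= C * hnorm k) -> Re `|chi T| <= C.
Proof.
move=> DT C0 hT; rewrite leNgt; apply/negP => Clt; apply: nonunital_id.
set c := chi T in Clt.
have c0 : c != 0.
  by apply/eqP => c0; move: Clt; rewrite c0 normr0 /= ltNge C0.
have cp : 0 < Re `|c| by exact: le_lt_trans C0 Clt.
have nV : Re `|c^-1| = (Re `|c|)^-1.
  apply: (mulfI (lt0r_neq0 cp)); rewrite -Re_normM (divff c0) normr1.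
  by rewrite divff ?gt_eqF.
pose q := C / Re `|c|.
have q0 : 0 <= q by rewrite divr_ge0// ltW.
have q1 : q < 1 by rewrite ltr_pdivrMr// mul1r.
pose y : K -> K := c^-1 *: T.
have hy k : hnorm (y k) <= q * hnorm k.
  rewrite /y fctE hnormZ nV /q [C / _]mulrC -mulrA.
  by rewrite ler_wpM2l ?invr_ge0 ?(ltW cp).
have bopy : bounded_op y by apply: bop_scale; exact: unitization_bop.
have yD : D ((@id K) - y).
  have -> : (@id K) - y = (- c^-1) *: (T - c *: (@id K)).
    by rewrite scaleNr scalerBr scalerA mulVf// scale1r opprB.
  by apply: (oaZ opD); exact: characterP.
have hym m k : hnorm (iter m y k) <= q ^+ m * hnorm k.
  elim: m => [|m IH]; first by rewrite mul1r.
  apply: le_trans (hy _) _; rewrite exprS -mulrA; exact: ler_wpM2l.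
have bym m : bounded_op (iter m y).
  elim: m => [|m IH]; first exact: bop_id.
  exact: bop_comp bopy IH.
have ymD m : D ((@id K) - iter m y).
  elim: m => [|m IH].
    by rewrite (_ : _ - _ = 0); [exact: (oa0 opD)|rewrite subrr].
  have -> : (@id K) - iter m.+1 y =
      ((@id K) - iter m y) + (((@id K) - y) - (((@id K) - y) \o ((@id K) - iter m y))).
    apply/funext => k; rewrite !fctE /= (bopB bopy).
    rewrite (_ : k - iter m y k - (y k - y (iter m y k)) =
                 k - y k - (iter m y k - y (iter m y k))); last first.
      by rewrite !opprB addrACA [RHS]addrACA [- iter m y k - _]addrC.
    by rewrite subKr addrA subrK.
  apply: (oaD opD) => //; apply: (oaB opD) => //; exact: (oaM opD).
have [_ _ _ _ Dcl] := opD.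
apply: Dcl; first exact: bop_id.
move=> e e0.
have /cvgrPdist_lt/(_ e e0)[m _ /(_ m (leqnn m))] : (fun m => q ^+ m) @ \oo --> (0 : R).
  by apply: cvg_expr; rewrite ger0_norm.
rewrite sub0r normrN ger0_norm ?exprn_ge0// => qm.
exists ((@id K) - iter m y) => //.
rewrite opprB addrC subrK; apply: (@le_lt_trans _ _ (q ^+ m)%:E); last by rewrite lte_fin.
by apply/opnormP; [exact: (bym m).1|exact: exprn_ge0|exact: hym].
Qed.

Lemma character_Re_le T (C : R) : D1 T -> 0 <= C ->
  (forall k, hnorm (T k) <= C * hnorm k) -> Re (chi T) <= C.
Proof.
by move=> DT C0 hT; apply: le_trans (Re_le_norm _) _; exact: character_contractive.
Qed.

(** The characters of an approximating sequence converge because the character is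
    contractive; subtracting them leaves a convergent sequence in [D]. *)
Lemma unitization_closed : norm_closed D1.
Proof.
move=> T bT hT.
have /choice[a ha] m : exists a, D1 a /\
    forall k, hnorm (T k - a k) <= harmonic m * hnorm k.
  have [a Da /ltW ah] := hT _ (harmonic_gt0 m); exists a; split => //.
  have ba := unitization_bop Da.
  have bTa : bounded_op (T - a).
    by rewrite -scaleN1r; apply: bop_add => //; exact: bop_scale.
  by move: ah => /(opnormP bTa.1 (harmonic_ge0 m)).
have Da m := (ha m).1.
have dist m n : Re `|chi (a m) - chi (a n)| <= harmonic m + harmonic n.
  have D1mn : D1 (a m - a n).
    by rewrite -(scaleN1r (a n)); apply: unitizationD => //; exact: unitizationZ.
  have -> : chi (a m) - chi (a n) = chi (a m - a n).
    rewrite -(scaleN1r (a n)) (characterD (Da m) (unitizationZ (-1) (Da n))).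
    by rewrite (characterZ (-1) (Da n)) mulN1r.
  apply: character_contractive => // [|k]; first by rewrite addr_ge0 ?harmonic_ge0.
  have -> : (a m - a n) k = (T k - a n k) - (T k - a m k).
    by rewrite !fctE opprB [RHS]addrC addrA subrK.
  apply: le_trans (hnormB_le _ _) _; rewrite mulrDl addrC.
  by apply: lerD; exact: (ha _).2.
have small (e : R) : 0 < e -> exists N, forall m, (N <= m)%N -> harmonic m < e.
  move=> e0; have /cvgrPdist_lt/(_ e e0)[N _ hN] := @cvg_harmonic R.
  by exists N => m /hN; rewrite sub0r normrN gtr0_norm ?harmonic_gt0.
have cauchy (f : R[i] -> R) : (forall c (d : R[i]), `|f c - f d| <= Re `|c - d|) ->
    exists l : R, (fun m => f (chi (a m))) @ \oo --> l.
  move=> hf; apply: real_complete => e e0.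
  have [N hN] := small _ (divr_gt0 e0 (ltr0n R 2)).
  exists N => m n Nm Nn; apply: le_lt_trans (hf _ _) _.
  apply: le_lt_trans (dist _ _) _; have := hN m Nm; have := hN n Nn.
  move: (harmonic m) (harmonic n) => x y; lra.
have [lr hlr] : exists l : R, (fun m => Re (chi (a m))) @ \oo --> l.
  apply: cauchy => c d; rewrite -raddfB.
  by have := normc_ge_Re (c - d); rewrite lecE => /andP[].
have [li hli] : exists l : R, (fun m => Im (chi (a m))) @ \oo --> l.
  apply: cauchy => c d; rewrite -raddfB normc_def /= -sqrtr_sqr.
  by rewrite ler_sqrt ?addr_ge0 ?sqr_ge0// lerDr sqr_ge0.
exists (lr +i* li); have [_ _ _ _ Dcl] := opD; apply: Dcl.
  apply: bop_add => //; rewrite -scaleN1r; do 2 apply: bop_scale; exact: bop_id.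
move=> e e0; have e4 : 0 < e / 4 by rewrite divr_gt0.
have [N1 hN1] := small _ e4.
have /cvgrPdist_lt/(_ _ e4)[N2 _ hN2] := hlr.
have /cvgrPdist_lt/(_ _ e4)[N3 _ hN3] := hli.
pose m := maxn N1 (maxn N2 N3).
have h1 : harmonic m < e / 4 by apply: hN1; rewrite leq_maxl.
have h2 : `|lr - Re (chi (a m))| < e / 4.
  by apply: hN2 => /=; rewrite /m maxnCA leq_maxl.
have h3 : `|li - Im (chi (a m))| < e / 4.
  by apply: hN3 => /=; rewrite /m maxnA leq_maxr.
exists (a m - chi (a m) *: (@id K)); first exact: characterP.
have bS : bounded_op (T - (lr +i* li) *: (@id K) - (a m - chi (a m) *: (@id K))).
  apply: bop_add; last rewrite -scaleN1r; first apply: bop_add => //.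
    by rewrite -scaleN1r; do 2 apply: bop_scale; exact: bop_id.
  apply/bop_scale/bop_add; first exact: unitization_bop.
  by rewrite -scaleN1r; do 2 apply: bop_scale; exact: bop_id.
apply: (@le_lt_trans _ _ (3 * (e / 4))%:E); last by rewrite lte_fin; lra.
apply/opnormP; [exact: bS.1|by rewrite mulr_ge0// ltW|move=> k].
have -> : (T - (lr +i* li) *: (@id K) - (a m - chi (a m) *: (@id K))) k =
    (T k - a m k) - (lr +i* li - chi (a m)) *: k.
  by rewrite !fctE /= scalerBl !opprB addrACA [RHS]addrACA [- a m k - _]addrC.
apply: le_trans (hnormB_le _ _) _.
have hc : Re `|lr +i* li - chi (a m)| <= 2 * (e / 4).
  apply: le_trans (Re_norm_le_add _) _; rewrite !raddfB /=; move: h2 h3; lra.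
have hk := hnorm_ge0 k.
rewrite hnormZ; apply: le_trans (lerD ((ha m).2 k) (ler_wpM2r hk hc)) _.
by rewrite -mulrDl ler_wpM2r//; move: h1; lra.
Qed.

Lemma cstar_unitization : cstar_algebra D1.
Proof.
split.
  split.
  - exact: unitization_bop.
  - split; first by apply: unitization_sub; exact: (oa0 opD).
    exact: unitizationD.
  - exact: unitizationZ.
  - exact: unitizationM.
  - exact: unitization_closed.
move=> T DT; have [b Db hb] := csD.2 _ (characterP DT).
exists (b + conjc (chi T) *: (@id K)).
  apply: unitizationD; first exact: unitization_sub.
  by apply: unitizationZ; exact: unitization_id.
move=> x y.
have -> : T x = (T - chi T *: (@id K)) x + chi T *: x by rewrite !fctE subrK.
by rewrite innerDl hb innerDr innerZl innerZr conjcK.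
Qed.

Lemma unital_unitization : unital D1.
Proof.
exists id; split; [exact: unitization_id| |by []].
by apply/opnormP => // k; rewrite mul1r.
Qed.

End Unitization.

(** * Extending representations to the unitization *)

Section Extension.
Context {R : realType} {K L : hilbertType R} (D : set (K -> K)).
Hypothesis csD : cstar_algebra D.
Hypothesis nuD : ~ unital D.
Implicit Types (T S d e : K -> K) (c : R[i]).

Let opD : operator_algebra D := csD.1.
Let D1 := unitization D.
Let chi := character D.
Let opD1 : operator_algebra D1 := (cstar_unitization csD nuD).1.

(** Complete contractivity: the scalar matrix is the slice by [chi] of the matrix
    [1 (x) T] over [L (x) K], which has the norm of [T]. *)
Lemma character_rep : cc_representation D1 (fun T => chi T *: (@id L)).
Proof.
split.
- by move=> T _; apply: bop_scale; exact: bop_id.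
- by move=> T S DT DS; rewrite /chi (characterD csD nuD DT DS) scalerDl.
- by move=> c T DT; rewrite /chi (characterZ csD nuD c DT) scalerA.
- move=> T S DT DS; rewrite /chi (characterM csD nuD DT DS).
  by apply/funext => x; rewrite /= !fctE scalerA.
move=> n T DT; apply: lee_realP => M hM.
have bT i j : bounded_op (T i j) by exact: (oaP opD1).
have M0 := mxopnorm_ge0 bT hM.
move: hM => /(mxopnormP bT M0) hM.
apply/mxopnormP => // [i j|f].
  by rewrite mxE; apply: bop_scale; exact: bop_id.
pose x : 'M[tensor (L -> L) (K -> K)]_n := \matrix_(i, j) [:: ((@id L), T i j)].
have -> : map_mx (fun T => chi T *: (@id L)) T =
    \matrix_(i, j) \sum_(p <- x i j) (chi p.2 *: p.1).
  by apply/matrixP => i j; rewrite !mxE big_seq1.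
apply: (slice_map_bound (E := D1)) => //.
- exact: (oa0 opD1).
- exact: (oaD opD1).
- exact: (oaZ opD1).
- by move=> a b; exact: characterD.
- by move=> c a; exact: characterZ.
- by move=> a C; exact: character_Re_le.
- by move=> i j p; rewrite mxE inE => /eqP ->; exact: DT.
- move=> v; apply: (tvecnorm_amplify M0 hM) => h i.
  rewrite slice_mxtapply; apply: eq_bigr => j _.
  rewrite slice_tapply mxE big_seq1 /slice (bop_sum _ _ _ (bT i j)).
  by apply: eq_bigr => q _; rewrite (bopZ _ _ (bT i j)).
Qed.

Context (rho : (K -> K) -> L -> L).
Hypothesis ccrho : cc_representation D rho.

Definition rep_unitization T : L -> L :=
  rho (T - chi T *: (@id K)) + chi T *: (@id L).

Let rho1 := rep_unitization.

Lemma rep_unitization_alg d : D d -> rho1 d = rho d.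
Proof.
move=> Dd; rewrite /rho1 /rep_unitization /chi (character_alg csD nuD Dd).
by rewrite !scale0r subr0 addr0.
Qed.

Let rho1E d c : D d -> rho1 (d + c *: (@id K)) = rho d + c *: (@id L).
Proof.
move=> Dd; rewrite /rho1 /rep_unitization /chi.
by rewrite (character_uniq csD nuD (c := c)) addrK.
Qed.

Let dec T : D1 T -> exists d c, D d /\ T = d + c *: (@id K).
Proof.
move=> DT; exists (T - chi T *: (@id K)), (chi T); split; last by rewrite subrK.
exact: characterP.
Qed.

Let rho1_bop T : D1 T -> bounded_op (rho1 T).
Proof.
move=> /dec[d [c [Dd ->]]]; rewrite rho1E//; apply: bop_add.
  exact: (repP ccrho).
by apply: bop_scale; exact: bop_id.
Qed.

Let rho1M T S : D1 T -> D1 S -> rho1 (T \o S) = rho1 T \o rho1 S.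
Proof.
move=> /dec[t [c [Dt ->]]] /dec[s [d [Ds ->]]].
have bt := oaP opD Dt; have brt := repP ccrho Dt.
have -> : (t + c *: (@id K)) \o (s + d *: (@id K)) =
    ((t \o s) + (c *: s + d *: t)) + (c * d) *: (@id K).
  apply/funext => k; rewrite /= !fctE (bopD bt) (bopZ _ _ bt) scalerDr scalerA.
  by rewrite addrA -[t (s k) + _ + _]addrA [d *: _ + _]addrC.
have Dts := oaM opD Dt Ds; have Dcs := oaZ opD c Ds; have Ddt := oaZ opD d Dt.
have Dsum := oaD opD Dcs Ddt.
rewrite !rho1E//; last exact: (oaD opD).
rewrite (repD ccrho Dts Dsum) (repD ccrho Dcs Ddt) (repM ccrho Dt Ds).
rewrite (repZ ccrho _ Ds) (repZ ccrho _ Dt).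
apply/funext => x; rewrite /= !fctE (bopD brt) (bopZ _ _ brt) scalerDr scalerA.
by rewrite [RHS]addrA -[rho t (rho s x) + _ + _ in RHS]addrA [d *: _ + _]addrC.
Qed.

(** On the essential subspace of [rho] the extension of [T] is a strong limit of
    the [rho (T e)]; on the kernel it is the scalar [chi T]. *)
Lemma rep_unitizationP : cc_representation D1 rho1.
Proof.
split => //.
- move=> T S /dec[t [c [Dt ->]]] /dec[s [d [Ds ->]]].
  by rewrite addrACA -scalerDl !rho1E ?(repD ccrho)// ?scalerDl 1?addrACA//; exact: (oaD opD).
- move=> c T /dec[t [d [Dt ->]]].
  by rewrite scalerDr scalerA !rho1E ?(repZ ccrho)// ?scalerDr ?scalerA//; exact: (oaZ opD).
move=> n T DT; apply: lee_realP => M hM.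
have bT i j : bounded_op (T i j) by exact: (oaP opD1).
have M0 := mxopnorm_ge0 bT hM.
move: hM => /(mxopnormP bT M0) hM.
have brho1 i j : bounded_op (map_mx rho1 T i j) by rewrite mxE; exact: rho1_bop.
apply/mxopnormP => //; apply: (matrix_bound_glue csD ccrho) => //.
- move=> i j d y x Dd xk; rewrite mxE -(rep_unitization_alg Dd).
  have := rho1M (DT i j) (unitization_sub Dd).
  move=> /(congr1 (fun f => f y)) /= <-.
  have DTd := unitization_ideall csD nuD (DT i j) Dd.
  rewrite rep_unitization_alg// innerC.
  by rewrite (ker_orth_span csD ccrho xk (rep_span_rho rho y DTd)) conjc0.
- move=> i j x xk d Dd; rewrite mxE /rho1 /rep_unitization fctE (xk _ (characterP (DT i j))).
  by rewrite add0r fctE (bopZ _ _ (repP ccrho Dd)) xk// scaler0.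
- move=> e v De e1.
  pose Te : 'M[K -> K]_n := \matrix_(i, j) (T i j \o e).
  have DTe i j : D (Te i j) by rewrite mxE; exact: (unitization_ideall csD nuD (DT i j) De).
  have -> : mxapp (map_mx rho1 T) (fun i => rho e (v i)) = mxapp (map_mx rho Te) v.
    apply/funext => i; apply: eq_bigr => j _; rewrite !mxE.
    rewrite -(rep_unitization_alg De).
    have := rho1M (DT i j) (unitization_sub De) => /(congr1 (fun f => f (v j))) /= <-.
    by rewrite (rep_unitization_alg (unitization_ideall csD nuD (DT i j) De)).
  apply: (rep_mx_bound opD ccrho) => // w.
  have -> : mxapp Te w = mxapp T (fun i => e (w i)).
    by apply/funext => i; apply: eq_bigr => j _; rewrite mxE.
  apply: le_trans (hM _) _; rewrite ler_wpM2l//; exact: vecnorm_contr.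
- move=> v vk.
  have -> : mxapp (map_mx rho1 T) v = mxapp (map_mx (fun T => chi T *: (@id L)) T) v.
    apply/funext => i; apply: eq_bigr => j _; rewrite !mxE /rho1 /rep_unitization fctE.
    by rewrite (vk j _ (characterP (DT i j))) add0r.
  exact: (rep_mx_bound opD1 character_rep).
Qed.

Lemma rep_unitization_commutes (f : L -> L) : bounded_op f ->
  (forall d, D d -> f \o rho d = rho d \o f) ->
  forall T, D1 T -> f \o rho1 T = rho1 T \o f.
Proof.
move=> bf fD T /dec[d [c [Dd ->]]]; rewrite rho1E//.
apply/funext => x; rewrite /= !fctE (bopD bf) (bopZ _ _ bf).
by have := fD d Dd => /(congr1 (fun g => g x)) /= ->.
Qed.

End Extension.

(** * Exchanging the tensor factors, multiplying the second one *)

Section Swap.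
Context {R : realType}.

Definition tswap (X Y : Type) (t : tensor X Y) : tensor Y X :=
  [seq (p.2, p.1) | p <- t].

Lemma tswapK (X Y : Type) (t : tensor X Y) : tswap (tswap t) = t.
Proof. by elim: t => //= -[a b] t {2}<-. Qed.

Lemma mem_tswap (X Y : eqType) (t : tensor X Y) p :
  (p \in tswap t) = ((p.2, p.1) \in t).
Proof.
apply/mapP/idP => [[q qt ->]|pt]; first by case: q qt.
by exists (p.2, p.1) => //; case: p pt.
Qed.

Lemma tinner_swap (H K : hilbertType R) (u v : tensor H K) :
  tinner (tswap u) (tswap v) = tinner u v.
Proof.
rewrite /tinner big_map; apply: eq_bigr => p _; rewrite big_map.
by apply: eq_bigr => q _; rewrite mulrC.
Qed.

Lemma tvecnorm_swap (H K : hilbertType R) n (v : 'I_n -> tensor H K) :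
  tvecnorm (fun i => tswap (v i)) = tvecnorm v.
Proof.
by congr Num.sqrt; apply: eq_bigr => i _; rewrite tinner_swap.
Qed.

Lemma mxtapply_swap (H K : hilbertType R) n
    (x : 'M[tensor (H -> H) (K -> K)]_n) (v : 'I_n -> tensor H K) i :
  mxtapply (map_mx (@tswap _ _) x) (fun j => tswap (v j)) i = tswap (mxtapply x v i).
Proof.
rewrite /mxtapply [RHS](big_morph _ (fun a b => map_cat _ a b) (erefl _)).
apply: eq_bigr => j _; rewrite mxE /tapply map_allpairs.
by rewrite allpairs_mapl allpairs_mapr.
Qed.

Lemma minnorm_swap (H K : hilbertType R) n
    (x : 'M[tensor (H -> H) (K -> K)]_n) :
  minnorm (map_mx (@tswap _ _) x) = minnorm x.
Proof.
have le (H' K' : hilbertType R) (y : 'M[tensor (H' -> H') (K' -> K')]_n) :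
    (minnorm y <= minnorm (map_mx (@tswap _ _) y))%E.
  apply: ge_ereal_sup => _ [v /= v1 <-]; apply: ereal_sup_ubound.
  exists (fun i => tswap (v i)); first by rewrite /= tvecnorm_swap.
  rewrite -(tvecnorm_swap (mxtapply y v)); congr (tvecnorm _)%:E.
  by apply/funext => i; rewrite mxtapply_swap.
apply/le_anti; rewrite le andbT; apply: le_trans (le _ _ _) _.
rewrite (_ : map_mx _ (map_mx _ x) = x)//.
by apply/matrixP => i j; rewrite !mxE tswapK.
Qed.

Lemma commuting_reps_swap (H K L : hilbertType R) (A : set (H -> H))
    (E : set (K -> K)) (pi : (H -> H) -> L -> L) (rho : (K -> K) -> L -> L) :
  commuting_reps A E pi rho -> commuting_reps E A rho pi.
Proof. by case=> ccpi ccrho com; split => // b a Eb Aa; rewrite com. Qed.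

Lemma maxnorm_swap_le (H K : hilbertType R) (A : set (H -> H)) (E : set (K -> K)) n
    (x : 'M[tensor (H -> H) (K -> K)]_n) : mxtensor_in A E x ->
  (maxnorm A E x <= maxnorm E A (map_mx (@tswap _ _) x))%E.
Proof.
move=> xin; apply: ge_ereal_sup => _ [L [pi [rho [com ->]]]].
apply: ereal_sup_ubound; exists L, rho, pi; split; first exact: commuting_reps_swap.
congr mxopnorm; apply/matrixP => i j; rewrite !mxE /prod_rep big_map.
rewrite big_seq [RHS]big_seq; apply: eq_bigr => p px.
by have [Ap Ep] := xin _ _ _ px; case: com => _ _ com; exact: com.
Qed.

Lemma mxtensor_in_swap (H K : hilbertType R) (A : set (H -> H)) (E : set (K -> K)) n
    (x : 'M[tensor (H -> H) (K -> K)]_n) : mxtensor_in A E x ->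
  mxtensor_in E A (map_mx (@tswap _ _) x).
Proof. by move=> xin i j p; rewrite mxE mem_tswap => /xin[]. Qed.

Lemma min_eq_max_swap (H K : hilbertType R) (A : set (H -> H)) (E : set (K -> K)) :
  min_eq_max A E -> min_eq_max E A.
Proof.
move=> AE n x xin; have xs := mxtensor_in_swap xin.
rewrite -minnorm_swap AE//; apply/le_anti; rewrite maxnorm_swap_le// andbT.
apply: le_trans (maxnorm_swap_le xs) _.
rewrite (_ : map_mx _ (map_mx _ x) = x)//.
by apply/matrixP => i j; rewrite !mxE tswapK.
Qed.

End Swap.

Section RightMultiplication.
Context {R : realType} {H K : hilbertType R} {n : nat}.
Implicit Types (x : 'M[tensor (H -> H) (K -> K)]_n) (v : 'I_n -> tensor H K).
Implicit Types (e : K -> K) (M : R).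

Definition tmulr e (t : tensor (H -> H) (K -> K)) : tensor (H -> H) (K -> K) :=
  [seq (p.1, p.2 \o e) | p <- t].

Definition tvecmap e v : 'I_n -> tensor H K :=
  fun i => [seq (q.1, e q.2) | q <- v i].

Lemma mxtapply_tmulr e x v :
  mxtapply (map_mx (tmulr e) x) v = mxtapply x (tvecmap e v).
Proof.
apply/funext => i; apply: eq_bigr => j _.
by rewrite mxE /tapply allpairs_mapl allpairs_mapr.
Qed.

Lemma tvecnorm_contr e v : bounded_op e -> (forall k, hnorm (e k) <= hnorm k) ->
  tvecnorm (tvecmap e v) <= tvecnorm v.
Proof.
move=> be e1; rewrite -[X in _ <= X]mul1r.
apply: (@tvecnorm_amplify _ _ _ _ (fun y i => e (y i))) => // [y|h i].
  by rewrite mul1r; exact: vecnorm_contr.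
rewrite /slice big_map (bop_sum _ _ _ be).
by apply: eq_bigr => q _; rewrite (bopZ _ _ be).
Qed.

Lemma minnorm_tmulr e x M : bounded_op e -> (forall k, hnorm (e k) <= hnorm k) ->
  (forall i j p, p \in x i j -> bounded_op p.1) -> (minnorm x <= M%:E)%E ->
  (minnorm (map_mx (tmulr e) x) <= M%:E)%E.
Proof.
move=> be e1 bx xM; have M0 := minnorm_ge0 xM.
move: xM => /(minnormP bx M0) xM; apply/minnormP => // [i j p|v].
  by rewrite mxE => /mapP[q qx ->]; exact: bx qx.
rewrite mxtapply_tmulr; apply: le_trans (xM _) _.
by rewrite ler_wpM2l//; exact: tvecnorm_contr.
Qed.

End RightMultiplication.

(** * The maximal norm over the unitization *)

Section MaxNorm.
Context {R : realType} {H K : hilbertType R} (A : set (H -> H)) (E : set (K -> K)).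

Lemma maxnormP n (x : 'M[tensor (H -> H) (K -> K)]_n) (M : R) :
  (maxnorm A E x <= M%:E)%E <->
  (forall (L : hilbertType R) (pi : (H -> H) -> L -> L) (rho : (K -> K) -> L -> L),
    commuting_reps A E pi rho ->
    (mxopnorm (map_mx (prod_rep pi rho) x) <= M%:E)%E).
Proof.
split=> [h L pi rho com|h].
  by apply: le_trans h; apply: ereal_sup_ubound; exists L, pi, rho.
by apply: ge_ereal_sup => _ [L [pi [rho [com ->]]]]; exact: h.
Qed.

Lemma prod_repE (L : hilbertType R) (pi : (H -> H) -> L -> L)
    (rho : (K -> K) -> L -> L) t y :
  prod_rep pi rho t y = \sum_(p <- t) pi p.1 (rho p.2 y).
Proof. by rewrite /prod_rep fct_sumE. Qed.

Lemma prod_rep_bop (L : hilbertType R) (pi : (H -> H) -> L -> L)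
    (rho : (K -> K) -> L -> L) t : commuting_reps A E pi rho ->
  (forall p, p \in t -> A p.1 /\ E p.2) -> bounded_op (prod_rep pi rho t).
Proof.
move=> [ccpi ccrho _] tin; rewrite /prod_rep big_seq.
apply: (big_ind (@bounded_op R L)) => [||p /tin[Ap Ep]]; first exact: bop_zero.
  exact: bop_add.
by apply: bop_comp; [exact: (repP ccpi)|exact: (repP ccrho)].
Qed.

End MaxNorm.

Section UnitizationMinMax.
Context {R : realType} {H K : hilbertType R}.
Context (B : set (H -> H)) (D : set (K -> K)).
Hypothesis opB : operator_algebra B.
Hypothesis csD : cstar_algebra D.
Hypothesis nuD : ~ unital D.
Implicit Types (a b : H -> H) (T S d e : K -> K) (M : R).

Let opD : operator_algebra D := csD.1.
Let D1 := unitization D.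
Let chi := character D.
Let csD1 : cstar_algebra D1 := cstar_unitization csD nuD.
Let opD1 : operator_algebra D1 := csD1.1.

Lemma commuting_reps_restrict (L : hilbertType R) (pi : (H -> H) -> L -> L)
    (rho : (K -> K) -> L -> L) :
  commuting_reps B D1 pi rho -> commuting_reps B D pi rho.
Proof.
move=> [ccpi [rb rD rZ rM rn] com]; split => //; last first.
  by move=> a d Ba Dd; apply: com => //; exact: unitization_sub.
split.
- by move=> d Dd; apply: rb; exact: unitization_sub.
- by move=> d e Dd De; apply: rD; exact: unitization_sub.
- by move=> c d Dd; apply: rZ; exact: unitization_sub.
- by move=> d e Dd De; apply: rM; exact: unitization_sub.
- by move=> n T DT; apply: rn => i j; exact: unitization_sub.
Qed.

Lemma commuting_reps_extend (L : hilbertType R) (pi : (H -> H) -> L -> L)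
    (rho : (K -> K) -> L -> L) :
  commuting_reps B D pi rho -> commuting_reps B D1 pi (rep_unitization D rho).
Proof.
move=> [ccpi ccrho com]; split => //; first exact: rep_unitizationP.
move=> a T Ba DT; apply: rep_unitization_commutes => //.
  exact: (repP ccpi).
by move=> d Dd; exact: com.
Qed.

Lemma mxtensor_in_unitization n (x : 'M[tensor (H -> H) (K -> K)]_n) :
  mxtensor_in B D x -> mxtensor_in B D1 x.
Proof. by move=> xin i j p /xin[Bp Dp]; split => //; exact: unitization_sub. Qed.

Lemma maxnorm_unitization n (x : 'M[tensor (H -> H) (K -> K)]_n) :
  mxtensor_in B D x -> maxnorm B D1 x = maxnorm B D x.
Proof.
move=> xin; apply/le_anti/andP; split; apply: lee_realP => M /maxnormP hM;
  apply/maxnormP => L pi rho com.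
  by apply: hM; exact: commuting_reps_restrict.
have := hM _ _ _ (commuting_reps_extend com).
rewrite (_ : map_mx _ x = map_mx (prod_rep pi rho) x)//.
apply/matrixP => i j; rewrite !mxE /prod_rep big_seq [RHS]big_seq.
apply: eq_bigr => p px; have [_ Dp] := xin _ _ _ px.
by rewrite rep_unitization_alg.
Qed.

Lemma min_eq_max_ideal : min_eq_max B D1 -> min_eq_max B D.
Proof.
move=> h n x xin; rewrite h; last exact: mxtensor_in_unitization.
exact: maxnorm_unitization.
Qed.

Hypothesis BD : min_eq_max B D.
Context {n : nat} (x : 'M[tensor (H -> H) (K -> K)]_n).
Hypothesis xin : mxtensor_in B D1 x.

Let xB i j p : p \in x i j -> B p.1. Proof. by move=> /xin[]. Qed.
Let xD1 i j p : p \in x i j -> D1 p.2. Proof. by move=> /xin[]. Qed.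
Let xbop i j p : p \in x i j -> bounded_op p.1.
Proof. by move=> /xB; exact: (oaP opB). Qed.

Let xchi : 'M[H -> H]_n := \matrix_(i, j) \sum_(p <- x i j) chi p.2 *: p.1.

Let xchiB i j : B (xchi i j).
Proof.
rewrite mxE; apply: (oa_sum opB) => p px; apply: (oaZ opB); exact: xB px.
Qed.

Let xe_in e : D e -> mxtensor_in B D (map_mx (tmulr e) x).
Proof.
move=> De i j p; rewrite mxE => /mapP[q qx ->] /=; split; first exact: xB qx.
exact: (unitization_ideall csD nuD (xD1 qx) De).
Qed.

(** [rho] decomposes its space into the essential subspace of the ideal [D],
    where [x] is a limit of the [x (1 (x) e)], and its complement, where [x] acts
    through the slice by the character. *)
Lemma maxnorm_le_minnorm : (maxnorm B D1 x <= minnorm x)%E.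
Proof.
apply: lee_realP => M xM; apply/maxnormP => L pi rho com1.
have com := commuting_reps_restrict com1.
have [ccpi ccrho comD] := com; have [_ ccrho1 comD1] := com1.
have M0 := minnorm_ge0 xM.
have xM' := (minnormP xbop M0).1 xM.
have bT i j : bounded_op (map_mx (prod_rep pi rho) x i j).
  by rewrite mxE; apply: (prod_rep_bop com1) => p px; exact: xin px.
apply/mxopnormP => //; apply: (matrix_bound_glue csD ccrho) => //.
(* [x] maps [rho(D) L] to itself: [pi b] commutes with [rho d], and [D] is an
   ideal. *)
- move=> i j d y z Dd zk; rewrite mxE prod_repE inner_suml big_seq big1// => p px.
  have Dpd := unitization_ideall csD nuD (xD1 px) Dd.
  have -> : pi p.1 (rho p.2 (rho d y)) = rho (p.2 \o d) (pi p.1 y).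
    have := repM ccrho1 (xD1 px) (unitization_sub Dd) => /(congr1 (fun f => f y)) /= <-.
    by have := comD _ _ (xB px) Dpd => /(congr1 (fun f => f y)).
  by rewrite innerC (ker_orth_span csD ccrho zk (rep_span_rho rho _ Dpd)) conjc0.
- move=> i j z zk d Dd; rewrite mxE prod_repE (bop_sum _ _ _ (repP ccrho Dd)).
  rewrite big_seq big1// => p px.
  have := comD _ _ (xB px) Dd => /(congr1 (fun f => f (rho p.2 z))) /= <-.
  have := repM ccrho1 (unitization_sub Dd) (xD1 px) => /(congr1 (fun f => f z)) /= <-.
  rewrite zk ?(bop0 (repP ccpi (xB px)))//.
  exact: (unitization_idealr csD nuD (xD1 px) Dd).
- move=> e v De e1.
  have -> : mxapp (map_mx (prod_rep pi rho) x) (fun i => rho e (v i)) =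
      mxapp (map_mx (prod_rep pi rho) (map_mx (tmulr e) x)) v.
    apply/funext => i; apply: eq_bigr => j _; rewrite !mxE !prod_repE big_map.
    rewrite big_seq [RHS]big_seq; apply: eq_bigr => p px /=.
    by have := repM ccrho1 (xD1 px) (unitization_sub De) => /(congr1 (fun f => f (v j))) /= <-.
  have be := oaP opD De.
  have := minnorm_tmulr be e1 xbop xM; rewrite BD; last exact: xe_in.
  move=> /maxnormP/(_ _ _ _ com) h.
  apply: (mxopnormP _ M0).1 => // i j; rewrite mxE.
  by apply: (prod_rep_bop com) => p; exact: xe_in.
(* [rho] may send the unit of [D1] to a proper idempotent, which [r] applies; on
   the kernel, every [rho T] is [chi T] times this idempotent. *)
- move=> v vk; pose r v := fun i : 'I_n => rho (@id K) (v i).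
  have D1id : D1 (@id K) := unitization_id csD.
  have -> : mxapp (map_mx (prod_rep pi rho) x) v = mxapp (map_mx pi xchi) (r v).
    apply/funext => i; apply: eq_bigr => j _; rewrite !mxE prod_repE.
    rewrite (rep_sum opB ccpi); last first.
      by move=> p px; apply: (oaZ opB); exact: xB px.
    rewrite fct_sumE big_seq [RHS]big_seq; apply: eq_bigr => p px.
    rewrite (repZ ccpi _ (xB px)) /= fctE -(bopZ _ _ (repP ccpi (xB px))).
    congr (pi p.1 _); have Dp := characterP (xD1 px).
    rewrite [in LHS](unitizationE (xD1 px)).
    rewrite (repD ccrho1 (unitization_sub Dp) (unitizationZ csD _ D1id)).
    by rewrite (repZ ccrho1 _ D1id) !fctE vk// add0r.
  apply: le_trans (_ : M * vecnorm (r v) <= _); last first.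
    rewrite ler_wpM2l//; apply: vecnorm_contr; exact: (rep_contr csD1 ccrho1).
  apply: (rep_mx_bound opB ccpi xchiB M0).
  apply: (slice_map_bound (E := D1)) => //.
  + exact: (oa0 opD1).
  + exact: (oaD opD1).
  + exact: (oaZ opD1).
  + by move=> a b; exact: characterD.
  + by move=> c a; exact: characterZ.
  + by move=> a C; exact: character_Re_le.
Qed.

End UnitizationMinMax.

(** * The minimal norm over the unitization *)

Section MinLeMax.
Context {R : realType} {H K : hilbertType R}.
Context (B : set (H -> H)) (D : set (K -> K)).
Hypothesis opB : operator_algebra B.
Hypothesis csD : cstar_algebra D.
Hypothesis nuD : ~ unital D.
Implicit Types (a b : H -> H) (T S d e : K -> K) (M : R).

Let opD : operator_algebra D := csD.1.
Let D1 := unitization D.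
Let chi := character D.
Let csD1 : cstar_algebra D1 := cstar_unitization csD nuD.
Let opD1 : operator_algebra D1 := csD1.1.

Lemma inclusion_rep (V : hilbertType R) (A : set (V -> V)) :
  operator_algebra A -> cc_representation A id.
Proof.
move=> opA; split => // [a Aa|n T _]; first exact: (oaP opA).
by rewrite (_ : map_mx id T = T)//; apply/matrixP => i j; rewrite mxE.
Qed.

Let ccD : cc_representation D id := inclusion_rep opD.
Let ess := essential D (@id (K -> K)).
Let ker := rep_ker D (@id (K -> K)).

Let ker_stable T z : D1 T -> ker z -> ker (T z).
Proof.
move=> DT zk d Dd; have := zk _ (unitization_idealr csD nuD DT Dd); exact.
Qed.

Let ker_chi T z : D1 T -> ker z -> T z = chi T *: z.
Proof.
move=> DT zk; have := zk _ (characterP DT); rewrite /= !fctE.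
by move=> /eqP; rewrite subr_eq0 => /eqP.
Qed.

Let ess_orth T y z : D1 T -> ess y -> ker z -> inner (T y) z = 0.
Proof.
move=> DT [u uS uy] zk; have bT := oaP opD1 DT.
apply: (inner_lim0 (bop_cvg bT uy)) => k.
have [s sD ->] := uS k; rewrite (bop_sum _ _ _ bT) inner_suml big_seq big1// => p ps.
have DTp := unitization_ideall csD nuD DT (sD _ ps).
rewrite innerC (ker_orth_span csD ccD zk (rep_span_rho id p.2 DTp)).
exact: conjc0.
Qed.

Hypothesis BD : min_eq_max B D.
Context {n : nat} (x : 'M[tensor (H -> H) (K -> K)]_n).
Hypothesis xin : mxtensor_in B D1 x.

Let xB i j p : p \in x i j -> B p.1. Proof. by move=> /xin[]. Qed.
Let xD1 i j p : p \in x i j -> D1 p.2. Proof. by move=> /xin[]. Qed.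
Let xbop i j p : p \in x i j -> bounded_op p.1.
Proof. by move=> /xB; exact: (oaP opB). Qed.

Let xchi : 'M[H -> H]_n := \matrix_(i, j) \sum_(p <- x i j) chi p.2 *: p.1.

Let xchi_bop i j : bounded_op (xchi i j).
Proof.
apply: (oaP opB); rewrite mxE; apply: (oa_sum opB) => p px.
by apply: (oaZ opB); exact: xB px.
Qed.

(** The inclusion of [B] and the multiples of the identity given by the
    character form a commuting pair on [H]. *)
Let xchi_maxnorm M : (maxnorm B D1 x <= M%:E)%E -> (mxopnorm xchi <= M%:E)%E.
Proof.
move=> /maxnormP hM.
have com : commuting_reps B D1 id (fun T => chi T *: (@id H)).
  split; [exact: inclusion_rep|exact: character_rep|].
  move=> b T Bb DT; apply/funext => h /=.
  by rewrite !fctE (bopZ _ _ (oaP opB Bb)).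
have := hM _ _ _ com; rewrite (_ : map_mx _ x = xchi)//.
apply/matrixP => i j; rewrite !mxE /prod_rep big_seq [RHS]big_seq.
apply: eq_bigr => p px; apply/funext => h /=.
by rewrite !fctE (bopZ _ _ (xbop px)).
Qed.

Let xe_in e : D e -> mxtensor_in B D (map_mx (tmulr e) x).
Proof.
move=> De i j p; rewrite mxE => /mapP[q qx ->] /=; split; first exact: xB qx.
exact: (unitization_ideall csD nuD (xD1 qx) De).
Qed.

(** [x (1 (x) e)] has coefficients in [D], where the two norms agree, and every
    representation of [D] that computes its maximal norm extends to [D1]. *)
Let xe_bound M e : (maxnorm B D1 x <= M%:E)%E -> 0 <= M -> D e ->
  (forall k, hnorm (e k) <= hnorm k) -> forall v : 'I_n -> tensor H K,
  tvecnorm (mxtapply x (tvecmap e v)) <= M * tvecnorm v.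
Proof.
move=> /maxnormP hM M0 De e1 v.
suff : (minnorm (map_mx (tmulr e) x) <= M%:E)%E.
  rewrite (minnormP _ M0) => [h|i j p]; first by rewrite -mxtapply_tmulr; exact: h.
  by rewrite mxE => /mapP[q qx ->]; exact: xbop qx.
rewrite (BD (xe_in De)); apply/maxnormP => L pi rho com.
have com1 := commuting_reps_extend csD nuD com.
have [_ ccrho _] := com; have [_ ccrho1 _] := com1.
have bT i j : bounded_op (map_mx (prod_rep pi (rep_unitization D rho)) x i j).
  by rewrite mxE; apply: (prod_rep_bop com1) => p; exact: xin.
have := (mxopnormP bT M0).1 (hM _ _ _ com1) => h.
apply/mxopnormP => // [i j|w].
  by rewrite mxE; apply: (prod_rep_bop com) => p; exact: xe_in.
have -> : mxapp (map_mx (prod_rep pi rho) (map_mx (tmulr e) x)) w =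
    mxapp (map_mx (prod_rep pi (rep_unitization D rho)) x) (fun i => rho e (w i)).
  apply/funext => i; apply: eq_bigr => j _; rewrite !mxE !prod_repE big_map.
  rewrite big_seq [RHS]big_seq; apply: eq_bigr => p px /=.
  rewrite -(rep_unitization_alg csD nuD rho De).
  have := repM ccrho1 (xD1 px) (unitization_sub De) => /(congr1 (fun f => f (w j))) /= <-.
  by rewrite (rep_unitization_alg csD nuD rho (unitization_ideall csD nuD (xD1 px) De)).
apply: le_trans (h _) _; rewrite ler_wpM2l//; apply: vecnorm_contr.
exact: (rep_contr csD ccrho De e1).
Qed.

Let slice_mxtapply2 h (v : 'I_n -> tensor H K) i : slice h (mxtapply x v i) =
  \sum_j \sum_(p <- x i j) \sum_(q <- v j) inner (p.1 q.1) h *: p.2 q.2.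
Proof. by rewrite slice_mxtapply; apply: eq_bigr => j _; rewrite slice_tapply. Qed.

(** On vectors whose second factors are killed by [D], [x] acts as
    [xchi (x) 1]. *)
Let xker_bound M (v : 'I_n -> tensor H K) : (mxopnorm xchi <= M%:E)%E ->
  (forall i q, q \in v i -> ker q.2) ->
  tvecnorm (mxtapply x v) <= M * tvecnorm v.
Proof.
move=> hM vk; have M0 := mxopnorm_ge0 xchi_bop hM.
rewrite -(tvecnorm_swap (mxtapply x v)) -(tvecnorm_swap v).
apply: (tvecnorm_amplify M0 ((mxopnormP xchi_bop M0).1 hM)) => k i.
rewrite -mxtapply_swap slice_mxtapply; apply: eq_bigr => j _.
rewrite slice_tapply !mxE big_map /slice fct_sumE big_seq [RHS]big_seq.
apply: eq_bigr => p px; rewrite !big_map fctE (bop_sum _ _ _ (xbop px)) scaler_sumr.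
rewrite big_seq [RHS]big_seq; apply: eq_bigr => q qv /=.
rewrite (ker_chi (xD1 px) (vk _ _ qv)) innerZl (bopZ _ _ (xbop px)).
by rewrite scalerA.
Qed.

(** Split the second factors [k] of a test vector as [P k + (k - P k)] by the
    essential subspace and the kernel of [D] on [K].  Both the vector and its image
    under [x] split orthogonally; on the first part [x] is the limit of the
    [x (1 (x) e)], on the second it is the slice by the character. *)
Lemma minnorm_le_maxnorm : (minnorm x <= maxnorm B D1 x)%E.
Proof.
apply: lee_realP => M hM.
have hchi := xchi_maxnorm hM.
have M0 := mxopnorm_ge0 xchi_bop hchi.
apply/minnormP => // v.
have /choice[P hP] k : exists p, ess p /\ ker (k - p).
  by have [p] := essential_dec csD ccD k; exists p.
pose v1 := tvecmap P v; pose v0 := tvecmap (fun k => k - P k) v.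
set s := first_factors v ++ first_factors (mxtapply x v).
have first (f : K -> K) i p : p \in tvecmap f v i -> p.1 \in s.
  move=> /mapP[q qv ->]; rewrite mem_cat; apply/orP; left.
  exact: (first_factorsP qv).
have xfirst (f : K -> K) i p : p \in mxtapply x (tvecmap f v) i -> p.1 \in s.
  move=> pin; rewrite mem_cat; apply/orP; right.
  have : p.1 \in [seq q.1 | q <- mxtapply x (tvecmap f v) i] by exact: map_f.
  rewrite (_ : [seq q.1 | q <- _] = [seq q.1 | q <- mxtapply x v i]).
    by move=> /mapP[q qin ->]; exact: (first_factorsP qin).
  rewrite /mxtapply [LHS](big_morph _ (fun l l' => map_cat _ l l') (erefl _)).
  rewrite [RHS](big_morph _ (fun l l' => map_cat _ l l') (erefl _)).
  apply: eq_bigr => j _.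
  by rewrite /tapply !map_allpairs allpairs_mapr.
have vE : v = tvecmap id v.
  by apply/funext => i; rewrite /tvecmap map_id_in// => -[].
have [hs hsE] := @tvecnorm_parseval R H K n s.
have pyth (u u1 u0 : 'I_n -> tensor H K) :
    (forall i p, p \in u i -> p.1 \in s) -> (forall i p, p \in u1 i -> p.1 \in s) ->
    (forall i p, p \in u0 i -> p.1 \in s) ->
    (forall h i, slice h (u i) = slice h (u1 i) + slice h (u0 i)) ->
    (forall h i, inner (slice h (u1 i)) (slice h (u0 i)) = 0) ->
    tvecnorm u ^+ 2 = tvecnorm u1 ^+ 2 + tvecnorm u0 ^+ 2.
  move=> us u1s u0s uD uo; rewrite !hsE// -big_split; apply: eq_bigr => h _ /=.
  rewrite !vecnorm_sqr -big_split; apply: eq_bigr => i _ /=.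
  by rewrite uD hnormD_orth.
have vD : tvecnorm v ^+ 2 = tvecnorm v1 ^+ 2 + tvecnorm v0 ^+ 2.
  apply: pyth => [||| h i | h i].
  - by move=> i p; rewrite vE; exact: first.
  - exact: first.
  - exact: first.
  - rewrite /slice !big_map -big_split; apply: eq_bigr => q _ /=.
    by rewrite -scalerDr addrC subrK.
  - rewrite /slice !big_map inner_suml big1// => q _; rewrite inner_sumr big1// => q' _ /=.
    rewrite innerZl innerZr.
    by rewrite (ker_orth_essential csD ccD (hP q'.2).2 (hP q.2).1) !mulr0.
have xvD : tvecnorm (mxtapply x v) ^+ 2 =
    tvecnorm (mxtapply x v1) ^+ 2 + tvecnorm (mxtapply x v0) ^+ 2.
  apply: pyth => [||| h i | h i].
  - by move=> i p; rewrite vE; exact: xfirst.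
  - exact: xfirst.
  - exact: xfirst.
  - rewrite !slice_mxtapply2 -big_split; apply: eq_bigr => j _ /=.
    rewrite -big_split big_seq [RHS]big_seq; apply: eq_bigr => p px /=.
    rewrite !big_map -big_split; apply: eq_bigr => q _ /=.
    by rewrite -scalerDr -(bopD (oaP opD1 (xD1 px))) addrC subrK.
  - rewrite !slice_mxtapply2 inner_suml big1// => j _.
    rewrite inner_suml big_seq big1// => p px; rewrite big_map inner_suml big1// => q _.
    rewrite inner_sumr big1// => j' _; rewrite inner_sumr big_seq big1// => p' px'.
    rewrite big_map inner_sumr big1// => q' _ /=; rewrite innerZl innerZr.
    rewrite (ess_orth (xD1 px) (hP q.2).1 (ker_stable (xD1 px') (hP q'.2).2)).
    by rewrite !mulr0.
have b0 : tvecnorm (mxtapply x v0) <= M * tvecnorm v0.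
  by apply: xker_bound => // i q /mapP[q' _ ->]; exact: (hP q'.2).2.
have b1 : tvecnorm (mxtapply x v1) ^+ 2 <= (M * tvecnorm v1) ^+ 2.
  have [y|e he hey] := essential_approx csD ccD
      (vs := flatten [seq [seq P q.2 | q <- v i] | i <- enum 'I_n]).
    by move=> /flatten_mapP[i _ /mapP[q _ ->]]; exact: (hP q.2).1.
  have eP i q : q \in v i -> (fun k => e k (P q.2)) @ \oo --> P q.2.
    move=> qv; apply: hey; apply/flatten_mapP; exists i; first by rewrite mem_enum.
    by apply/mapP; exists q.
  have v1E k : tvecmap (e k) v1 = tvecmap (e k \o P) v.
    by apply/funext => i; rewrite /v1 /tvecmap -map_comp.
  apply: (@lim_le _ (fun k => tvecnorm (mxtapply x (tvecmap (e k) v1)) ^+ 2)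
    (fun=> (M * tvecnorm v1) ^+ 2)); last 2 first.
  - exact: cvg_cst.
  - move=> k; have [Dek ek1] := he k.
    rewrite ler_sqr ?nnegrE ?mulr_ge0 ?tvecnorm_ge0//; exact: xe_bound.
  rewrite hsE; last exact: xfirst.
  rewrite (_ : (fun k => _) = fun k => \sum_(h <- hs)
    vecnorm (fun i => slice h (mxtapply x (tvecmap (e k) v1) i)) ^+ 2); last first.
    by apply/funext => k; rewrite hsE// v1E; exact: xfirst.
  apply: cvg_sum_seq => h _.
  suff lim : (fun k => vecnorm (fun i => slice h (mxtapply x (tvecmap (e k) v1) i)))
      @ \oo --> vecnorm (fun i => slice h (mxtapply x v1 i)).
    by rewrite expr2; exact: cvgM.
  apply: vecnorm_cvg => i; rewrite slice_mxtapply2.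
  under eq_fun do rewrite slice_mxtapply2.
  apply: cvg_sum_seq => j _; apply: cvg_sum_seq => p px.
  rewrite /v1 big_map; under eq_fun do rewrite v1E big_map.
  apply: cvg_sum_seq => q qv.
  exact: (bop_cvg (bop_scale _ (oaP opD1 (xD1 px))) (eP _ _ qv)).
rewrite -ler_sqr ?nnegrE ?mulr_ge0 ?tvecnorm_ge0// exprMn xvD vD mulrDr.
rewrite -!exprMn lerD//.
by rewrite ler_sqr ?nnegrE ?mulr_ge0 ?tvecnorm_ge0.
Qed.

End MinLeMax.

Lemma min_eq_max_unitization (R : realType) (H K : hilbertType R)
    (B : set (H -> H)) (D : set (K -> K)) :
  operator_algebra B -> cstar_algebra D -> ~ unital D ->
  min_eq_max B D <-> min_eq_max B (unitization D).
Proof.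
move=> opB csD nuD; split; last exact: min_eq_max_ideal.
move=> BD n x xin; apply/le_anti.
by rewrite minnorm_le_maxnorm// maxnorm_le_minnorm.
Qed.

Theorem lemma5p5 (R : realType) (H : hilbertType R) (A : set (H -> H))
  (opA : operator_algebra A) (unitA : unital A)
  (detectsA : forall (K : hilbertType R) (C : set (K -> K)),
     cstar_algebra C -> unital C -> (min_eq_max A C <-> nuclear C))
  (K : hilbertType R) (D : set (K -> K))
  (cstarD : cstar_algebra D) (nonunitalD : ~ unital D) :
  min_eq_max A D <-> nuclear D.
Proof.
rewrite (min_eq_max_unitization opA cstarD nonunitalD).
rewrite (detectsA _ _ (cstar_unitization cstarD nonunitalD) (unital_unitization cstarD)).
split=> nucD L B csB; apply: min_eq_max_swap.
  apply/(min_eq_max_unitization csB.1 cstarD nonunitalD); apply: min_eq_max_swap.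
  exact: nucD.
apply/(min_eq_max_unitization csB.1 cstarD nonunitalD); apply: min_eq_max_swap.
exact: nucD.
Qed.
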